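(* There exist absolute constants $C>0$ and $c>0$ such that for all integers $d\ge1$, $1\le s\le cd$, all $\sigma>0$, any $\boldsymbol\theta\in B_0(s,d)$ and any $\boldsymbol\Sigma$ satisfying Assumption $(\varepsilon^*1)$, \[ \mathbf E_{\boldsymbol\theta,\boldsymbol\Sigma}\left[\frac{|\hat\sigma_S^2-\sigma^2|}{\sigma^2}\right]\le C\left(\frac sd+\frac{\|\tilde{\boldsymbol\Sigma}\|_F}{d}\right). \]
   Context: Model: one observes $\boldsymbol Y=\boldsymbol\theta+\sigma\boldsymbol\varepsilon\in\mathbb R^d$, $\boldsymbol\varepsilon\sim\mathcal N(\boldsymbol0,\boldsymbol\Sigma)$, $\boldsymbol\Sigma$ a covariance matrix with known diagonal entries $\sigma_i^2$, $\sigma>0$ unknown; $\mathbf E_{\boldsymbol\theta,\boldsymbol\Sigma}$ is the expectation under this model. $B_0(s,d)=\{\boldsymbol\theta:\|\boldsymbol\theta\|_0\le s\}$. Assumption $(\varepsilon^*1)$: $\min_i\sigma_i^2\ge c_*$ for a constant $c_*>0$. $\tilde Y_i=Y_i/\sigma_i$, $\tilde{\boldsymbol\Sigma}_{ij}=\boldsymbol\Sigma_{ij}/(\sigma_i\sigma_j)$. $\hat F_{Y^2}$ is the empirical c.d.f. of $\tilde Y_1^2,\dots,\tilde Y_d^2$, $F$ the c.d.f. of $\chi^2_1$. For $t>0$, $\hat\sigma_S^2(t)=t/F^{-1}(\hat F_{Y^2}(t))$ if $\hat F_{Y^2}(t)>0$ and $+\infty$ otherwise. Let $\hat t=\min\{t=2^\ell:\ell\in\mathbb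 Z,\ \hat F_{Y^2}(t)\ge0.5\}$ and $\hat\sigma_S^2=\hat\sigma_S^2(\hat t)$. *)

(* Defs.v *)
From HB Require Import structures.
From mathcomp Require Import all_boot all_order all_algebra.
From mathcomp Require Import all_classical all_reals all_analysis.
Set Implicit Arguments. Unset Strict Implicit. Unset Printing Implicit Defensive.
Import Order.TTheory GRing.Theory Num.Theory.
Local Open Scope classical_set_scope.
Local Open Scope ring_scope.

Section defs.
Variable R : realType.

Definition gauss_law (m v : R) : set R -> \bar R :=
  if v == 0 then \d_m else normal_prob m (Num.sqrt v).

Definition is_gaussian_vector {dT : measure_display} {T : measurableType dT}
  (P : probability T R) (d : nat) (Sigma : 'M[R]_d) (eps : T -> 'I_d -> R) :=
  (forall i, measurable_fun setT (fun x => eps x i)) /\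
  forall (a : 'I_d -> R) (B : set R), measurable B ->
    P [set x | B (\sum_i a i * eps x i)] =
    gauss_law 0 (\sum_i \sum_j a i * a j * Sigma i j) B.

Definition is_cov_matrix (d : nat) (Sigma : 'M[R]_d) :=
  (forall i j, Sigma i j = Sigma j i) /\
  forall a : 'I_d -> R, 0 <= \sum_i \sum_j a i * a j * Sigma i j.

Definition B0 (s d : nat) : set ('I_d -> R) :=
  [set th : 'I_d -> R | (#|[set i | th i != 0%R]| <= s)%N].

Definition tSigma (d : nat) (Sigma : 'M[R]_d) : 'M[R]_d :=
  \matrix_(i, j) (Sigma i j / (Num.sqrt (Sigma i i) * Num.sqrt (Sigma j j))).

Definition frob_norm (d : nat) (A : 'M[R]_d) : R :=
  Num.sqrt (\sum_i \sum_j A i j ^+ 2).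

Definition chi2_1_cdf (x : R) : R :=
  fine (normal_prob 0 1 [set z : R | z ^+ 2 <= x]).

Definition chi2_1_quantile (p : R) : \bar R :=
  ereal_inf [set x%:E | x in [set x : R | p <= chi2_1_cdf x]].

Definition Fhat (d : nat) (Sigma : 'M[R]_d) (Y : 'I_d -> R) (t : R) : R :=
  #|[set i | (Y i / Num.sqrt (Sigma i i)) ^+ 2 <= t]|%:R / d%:R.

(* hat sigma_S^2(t) = t / F^{-1}(hat F(t)) if hat F(t) > 0, +oo otherwise;
   t / (+oo) is read as 0 *)
Definition sigmaS_t (d : nat) (Sigma : 'M[R]_d) (Y : 'I_d -> R) (t : R) : \bar R :=
  if 0 < Fhat Sigma Y t then
    match chi2_1_quantile (Fhat Sigma Y t) with
    | r%:E => (t / r)%:E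
    | +oo%E => 0%E
    | -oo%E => +oo%E
    end
  else +oo%E.

Definition ell_set (d : nat) (Sigma : 'M[R]_d) (Y : 'I_d -> R) : set int :=
  [set l : int | 1 / 2 <= Fhat Sigma Y ((2 : R) ^ l)].

Definition ell_min_set (d : nat) (Sigma : 'M[R]_d) (Y : 'I_d -> R) : set int :=
  [set l | ell_set Sigma Y l /\ forall k, ell_set Sigma Y k -> l <= k].

(* hat sigma_S^2 = hat sigma_S^2(hat t), hat t = min{2^l : hat F(2^l) >= 1/2};
   +oo if that minimum does not exist (a null event). *)
Definition sigmaS_hat (d : nat) (Sigma : 'M[R]_d) (Y : 'I_d -> R) : \bar R :=
  if `[< exists l, ell_min_set Sigma Y l >]
  then sigmaS_t Sigma Y ((2 : R) ^ xget 0 (ell_min_set Sigma Y))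
  else +oo%E.

End defs.

(* Main.v *)
Require Import Defs.
From HB Require Import structures.
From mathcomp Require Import all_boot all_order all_algebra.
From mathcomp Require Import all_classical all_reals all_analysis.
From mathcomp Require Import measurable_realfun ring lra.
Import Order.TTheory GRing.Theory Num.Theory.
Import numFieldNormedType.Exports.
Local Open Scope classical_set_scope.
Local Open Scope ring_scope.

(* Let Z_i := eps_i / sqrt (Sigma i i), rho_ij := tSigma i j and
   eta := frob_norm (tSigma Sigma) / d.  For an even function f of a standard
   Gaussian pair with correlation rho, cov (f Z_i, f Z_j) <= rho^2 var f: on
   combinations of cos (a x) the Gaussian characteristic function turns both
   sides into explicit quadratic forms, compared through the power series of
   cosh, and indicators of symmetric intervals are bounded pointwise limits of
   such combinations.  Hence the empirical c.d.f. N of the Z_i^2 satisfies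
   E (N u - F u)^2 <= eta^2 (1 - F u) <= 64 eta^2 / u^2, while Fhat (sigma^2 u)
   differs from N u by at most s / d.
   Let v be the dyadic scale 2^l0 / sigma^2 in ]1/32, 1/16].  Whatever the
   selected scale is, the relative error is, for some k, at most a constant times
   s/d + eta + u (N u - F u)^2 / eta with u = 2^k v: if the selected scale is at
   most v or exceeds 2^9 v, then N - F is bounded below at v, resp. at the
   preceding scale; in between, the quantile function of F is Lipschitz.
   Summing the expectations over k gives a convergent geometric series. *)

(** * Characteristic function of the standard Gaussian law *)

Section gaussian.
Variable R : realType.
Local Notation mu := (@lebesgue_measure R).
Local Notation gamma := (@normal_prob R 0 1).

Lemma integrable_bounded {d : measure_display} {T : measurableType d}
    (P : probability T R) (f : T -> R) (M : R) :
  measurable_fun setT f -> (forall x, `|f x| <= M) ->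
  P.-integrable setT (EFin \o f).
Proof.
move=> mf fM; apply: measurable_bounded_integrable => //.
  by apply: le_lt_trans (ltry 1); exact: probability_le1.
by exists M; split; [exact: num_real|move=> y My x _; exact: le_trans (ltW My)].
Qed.

(** Change of variables by the Radon-Nikodym derivative, which agrees almost everywhere with
    [normal_pdf] because both have the same integral over every measurable set. *)
Lemma Rintegral_normal_prob (m s : R) (f : R -> R) :
  (normal_prob m s).-integrable setT (EFin \o f) ->
  \int[normal_prob m s]_x f x = \int[mu]_x (f x * normal_pdf m s x).
Proof.
move=> intf; rewrite /Rintegral; congr fine.
under [RHS]eq_integral do rewrite EFinM.
have mf := measurable_int _ intf.
rewrite -(Radon_Nikodym_change_of_variables (normal_prob_dominates m s))//=.
have mpdf : measurable_fun [set: R] (fun x => (normal_pdf m s x)%:E).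
  by apply/measurable_EFinP; exact: measurable_normal_pdf.
apply: ae_eq_integral => //.
- apply: emeasurable_funM => //; apply: (measurable_int mu).
  by apply: Radon_Nikodym_integrable; exact: normal_prob_dominates.
- exact: emeasurable_funM.
- apply: ae_eqe_mul2l => /=.
  rewrite Radon_NikodymE//=; first exact: normal_prob_dominates.
  move=> abmu; case: cid => /= h [h1 h2 h3].
  apply: integral_ae_eq => //=.
  by move=> E _ mE; rewrite -h3.
Qed.

Let g (x : R) : R := normal_pdf 0 1 x.

Let gE x : g x = normal_peak (1 : R) * expR (- (x ^+ 2) / 2).
Proof. by rewrite /g normal_pdfE ?oner_eq0// /normal_fun subr0 expr1n. Qed.

Let g_ge0 x : 0 <= g x. Proof. exact: normal_pdf_ge0. Qed.

Let mg : measurable_fun setT g. Proof. exact: measurable_normal_pdf. Qed.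

Let sqrt2_neq0 : Num.sqrt (2 : R) != 0.
Proof. by rewrite sqrtr_eq0 -ltNge. Qed.

Lemma normal_pdf_sqrt2E (x : R) :
  normal_pdf 0 (Num.sqrt 2) x = normal_peak (Num.sqrt 2) * expR (- (x ^+ 2) / 4).
Proof.
rewrite normal_pdfE// /normal_fun subr0 sqr_sqrtr//.
by congr (_ * expR (_ / _)); rewrite -mulr_natr -natrM.
Qed.

Let g_peak_ratio : normal_peak (1 : R) = Num.sqrt 2 * normal_peak (Num.sqrt 2).
Proof.
rewrite /normal_peak expr1n mul1r sqr_sqrtr// -mulrnAr sqrtrM//.
by rewrite invfM mulrA divff// mul1r.
Qed.

(** Splits off half of the Gaussian exponent. What remains is a multiple of the N(0,2) density,
    still integrable, and the factor exp (- x^2 / 4) can absorb a factor |x| or yield a tail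
    bound. *)
Let g_split x : g x = Num.sqrt 2 * normal_pdf 0 (Num.sqrt 2) x * expR (- (x ^+ 2) / 4).
Proof.
rewrite gE normal_pdf_sqrt2E g_peak_ratio -!mulrA -expRD; do 3 f_equal; lra.
Qed.

Lemma normal_pdf1_split (x : R) : normal_pdf 0 1 x =
  Num.sqrt 2 * normal_pdf 0 (Num.sqrt 2) x * expR (- (x ^+ 2) / 4).
Proof. exact: g_split. Qed.

(** Since (|x| / 2 - 1)^2 >= 0, one has |x| <= 1 + x^2 / 4 <= exp (x^2 / 4). This gives the
    integrable majorant for the derivative of [psi]. *)
Let xg_le x : `|x| * g x <= Num.sqrt 2 * normal_pdf 0 (Num.sqrt 2) x.
Proof.
rewrite g_split mulrCA ler_piMr ?mulr_ge0 ?sqrtr_ge0 ?normal_pdf_ge0//.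
rewrite mulNr expRN ler_pdivrMr ?expR_gt0// mul1r.
apply: le_trans (expR_ge1Dx _); rewrite -[x ^+ 2]real_normK ?num_real//.
have := sqr_ge0 (`|x| / 2 - 1); set y := `|x|; lra.
Qed.

Let int_g : mu.-integrable setT (EFin \o g).
Proof. exact: integrable_normal_pdf. Qed.

Let int_G : mu.-integrable setT
  (EFin \o (fun x => Num.sqrt 2 * normal_pdf 0 (Num.sqrt 2) x)).
Proof.
rewrite (_ : _ \o _ = fun x => (Num.sqrt 2)%:E * (normal_pdf 0 (Num.sqrt 2) x)%:E)%E//.
by apply: integrableZl => //; exact: integrable_normal_pdf.
Qed.


Let mcos : measurable_fun setT (@cos R).
Proof. by apply: continuous_measurable_fun; exact: continuous_cos. Qed.

Let msin : measurable_fun setT (@sin R).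
Proof. by apply: continuous_measurable_fun; exact: continuous_sin. Qed.

Let mscale (a : R) : measurable_fun setT (fun x : R => a * x).
Proof. exact: measurable_funM. Qed.

Let int_cosg (a : R) : mu.-integrable setT (EFin \o (fun x => cos (a * x) * g x)).
Proof.
apply: le_integrable int_g => //.
  apply/measurable_EFinP; apply: measurable_funM => //.
  exact: measurableT_comp.
by move=> x _ /=; rewrite lee_fin normrM ler_piMl// cos_max.
Qed.

Let int_xsing (a : R) :
  mu.-integrable setT (EFin \o (fun x => x * sin (a * x) * g x)).
Proof.
apply: le_integrable int_G => //.
  apply/measurable_EFinP; apply: measurable_funM => //.
  by apply: measurable_funM => //; exact: measurableT_comp.
move=> x _ /=; rewrite lee_fin [leRHS]ger0_norm ?mulr_ge0 ?sqrtr_ge0 ?normal_pdf_ge0//.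
apply: le_trans (xg_le x); rewrite !normrM (ger0_norm (g_ge0 x)).
by rewrite ler_wpM2r// ler_piMr// sin_max.
Qed.

Let is_derive_cosg (a x : R) :
  is_derive a 1 (fun b => cos (b * x) * g x) (- (x * sin (a * x) * g x)).
Proof.
have h1 : is_derive a 1 (fun b : R => b * x) x.
  have := @is_deriveM _ R^o id (cst x) a 1 1 0 (is_derive_id _ _) (is_derive_cst _ _ _).
  by rewrite scaler0 add0r [_ *: _]mulr1.
have h2 : is_derive a 1 (fun b : R => cos (b * x)) (- sin (a * x) * x).
  exact: (is_derive1_comp (f := cos) (g := fun b => b * x)).
have := @is_deriveM _ R^o (fun b : R => cos (b * x)) (cst (g x)) a 1 _ 0 h2 (is_derive_cst _ _ _).
rewrite scaler0 add0r /cst => h3.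
apply: is_derive_eq h3 _; rewrite -[LHS]/(g x * _); ring.
Qed.

(** The Gaussian characteristic function; it is real because the law is symmetric. *)
Let psi (a : R) := \int[mu]_x (cos (a * x) * g x).

(** Differentiation under the integral sign; the majorant from [xg_le] does not depend on the
    parameter. *)
Let is_derive_psi (a : R) : is_derive a 1 psi (- \int[mu]_x (x * sin (a * x) * g x)).
Proof.
have ia : `]a - 1, a + 1[%classic a by rewrite /= in_itv/=; apply/andP; split; lra.
have d1 (b y : R) : partial1of2 (fun b x : R => cos (b * x) * g x) b y = - (y * sin (b * y) * g y).
  by rewrite partial1of2E; have [_ ->] := is_derive_cosg b y.
have intf (x : R) : `]a - 1, a + 1[%classic x ->
    mu.-integrable setT (EFin \o (fun y => cos (x * y) * g y)) by [].
have derf (x y : R) : `]a - 1, a + 1[%classic x -> [set: R] y ->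
    derivable (fun b : R => cos (b * y) * g y) x 1 by [].
have G0 (y : R) : 0 <= Num.sqrt 2 * normal_pdf 0 (Num.sqrt 2) y.
  by rewrite mulr_ge0 ?sqrtr_ge0 ?normal_pdf_ge0.
have Gub (x y : R) : `]a - 1, a + 1[%classic x -> [set: R] y ->
   `|partial1of2 (fun b x : R => cos (b * x) * g x) x y| <= Num.sqrt 2 * normal_pdf 0 (Num.sqrt 2) y.
  move=> _ _; rewrite d1 normrN.
  apply: le_trans (xg_le y); rewrite !normrM (ger0_norm (g_ge0 y)).
  by rewrite ler_wpM2r// ler_piMr// sin_max.
apply: DeriveDef.
  exact: (derivable_under_integral measurableT ia intf derf G0 int_G Gub).
rewrite -derive1E (differentiation_under_integral measurableT ia intf derf G0 int_G Gub).
rewrite -mulN1r -RintegralZl//; apply: eq_Rintegral => y _.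
by rewrite d1 mulN1r.
Qed.

(* Stein's identity *)
Let psi_parts (a : R) : \int[mu]_x (x * sin (a * x) * g x) = a * psi a.
Proof.
pose F x := g x * sin (a * x).
pose f x := a * (cos (a * x) * g x) - x * sin (a * x) * g x.
have dF (x : R) : is_derive x 1 F (f x).
  have e1 : is_derive x 1 (fun b : R => - b ^+ 2 / 2) (- x).
    have := @is_deriveM _ R^o (- (id ^+ 2)) (cst 2^-1) x 1 _ 0 (is_deriveN (is_deriveX 2 (is_derive_id _ _))) (is_derive_cst _ _ _).
    rewrite scaler0 add0r => h; apply: is_derive_eq h _.
    rewrite -[LHS]/(2^-1 * (- (2%:R * x ^+ 1 * 1))); by field.
  have e2 : is_derive x 1 (fun b : R => expR (- b ^+ 2 / 2)) (expR (- x ^+ 2 / 2) * - x).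
    exact: (is_derive1_comp (f := expR) (g := fun b : R => - b ^+ 2 / 2)).
  have e3 : is_derive x 1 g (- x * g x).
    rewrite (_ : g = cst (normal_peak 1) * (fun b : R => expR (- b ^+ 2 / 2))); last first.
      by apply/funext => z; rewrite gE.
    have := @is_deriveM _ R^o _ _ x 1 _ _ (is_derive_cst (normal_peak (1 : R)) _ _) e2.
    rewrite scaler0 addr0 => h; apply: is_derive_eq h _.
    rewrite -[LHS]/(normal_peak 1 * (expR (- x ^+ 2 / 2) * - x)).
    rewrite -[RHS]/(- x * (normal_peak 1 * expR (- x ^+ 2 / 2))); ring.
  have e4 : is_derive x 1 (fun b : R => a * b) a.
    have := @is_deriveM _ R^o (cst a) id x 1 0 1 (is_derive_cst _ _ _) (is_derive_id _ _).
    by rewrite scaler0 addr0 [_ *: _]mulr1.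
  have e5 : is_derive x 1 (fun b : R => sin (a * b)) (cos (a * x) * a).
    exact: (is_derive1_comp (f := sin) (g := fun b => a * b)).
  have := @is_deriveM _ R^o _ _ x 1 _ _ e3 e5.
  move=> h; apply: is_derive_eq h _.
  rewrite -[LHS]/(g x * (cos (a * x) * a) + sin (a * x) * (- x * g x)) /f; ring.
have cg : continuous g by apply: continuous_normal_pdf; exact: oner_neq0.
have cax : continuous (fun x : R => a * x).
  by move=> x; apply: cvgM; [exact: cvg_cst|exact: cvg_id].
have ccos : continuous (fun x => cos (a * x)).
  by move=> x; apply: continuous_comp; [exact: cax|exact: continuous_cos].
have csin : continuous (fun x => sin (a * x)).
  by move=> x; apply: continuous_comp; [exact: cax|exact: continuous_sin].
have cF : continuous F.
  by move=> x; apply: cvgM; [exact: cg|exact: csin].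
have cf : continuous f.
  move=> x; apply: cvgB; last by apply: cvgM; [apply: cvgM; [exact: cvg_id|exact: csin]|exact: cg].
  by apply: cvgM; [exact: cvg_cst|apply: cvgM; [exact: ccos|exact: cg]].
have if1 : mu.-integrable setT (EFin \o (fun x => a * (cos (a * x) * g x))).
  rewrite (_ : _ \o _ = fun x => a%:E * (cos (a * x) * g x)%:E)%E; last by [].
  by apply: integrableZl => //; exact: int_cosg.
have intf : mu.-integrable setT (EFin \o f).
  rewrite (_ : _ \o _ = (fun x => (a * (cos (a * x) * g x))%:E - (x * sin (a * x) * g x)%:E))%E; last by [].
  by apply: integrableB => //; exact: int_xsing.
pose D n : set R := `[- n.+1%:R, n.+1%:R]%classic.
have FTC n : (\int[mu]_(x in D n) (f x)%:E = (F n.+1%:R - F (- n.+1%:R))%:E)%E.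
  rewrite EFinB; apply: continuous_FTC2.
  - by rewrite gtrN// ltr0n.
  - exact: continuous_subspaceT.
  - split=> [x _||]; first by have [] := dF x.
    + by apply: cvg_at_right_filter; exact: cF.
    + by apply: cvg_at_left_filter; exact: cF.
  - by move=> x _; rewrite derive1E; have [_ ->] := dF x.
have mf : measurable_fun setT f by exact: continuous_measurable_fun.
have mEf : measurable_fun setT (EFin \o f) by apply/measurable_EFinP.
have mD n : measurable (D n) by exact: measurable_itv.
(* The integrals of [f = F'] over [-(n+1), n+1] are evaluated in two ways: by dominated convergence
   they tend to the integral over the line, by the fundamental theorem of calculus they are boundary
   terms. *)
have cvgf : (\int[mu]_(x in D n) (f x)%:E)%E @[n --> \oo] --> (\int[mu]_x (f x)%:E)%E.
  have -> : (fun n => \int[mu]_(x in D n) (f x)%:E)%E =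
      (fun n => \int[mu]_x ((EFin \o f) \_ (D n)) x)%E.
    by apply/funext => n; rewrite integral_mkcond.
  have [] := @dominated_convergence _ _ _ mu setT measurableT
    (fun n => (EFin \o f) \_ (D n)) (EFin \o f) (abse \o (EFin \o f)) => //.
  - move=> n; apply: (measurable_restrictT _ (mD n)).1.
    exact: measurable_funTS.
  - apply: aeW => x _; apply: cvg_near_cst.
    near=> n; rewrite patchE mem_set// /D /= in_itv/= -ler_norml.
    near: n; exists (Num.truncn `|x|) => // n /= nx.
    by rewrite (le_trans (ltW (truncnS_gt _)))// ler_nat.
  - exact: integrable_abse.
  - by apply: aeW => x n _; rewrite /= patchE; case: ifPn => // _; rewrite /point/= normr0 lee_fin.
pose C := Num.sqrt 2 * normal_peak (Num.sqrt (2 : R)).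
(* As |x| |F x| is bounded, the boundary terms are O(1 / (n+1)). *)
have F_le (x : R) : `|x| * `|F x| <= C.
  rewrite /F normrM (ger0_norm (g_ge0 x)) mulrA.
  apply: (@le_trans _ _ (`|x| * g x)); first by rewrite ler_piMr ?mulr_ge0// sin_max.
  apply: le_trans (xg_le x) _.
  by rewrite ler_wpM2l ?sqrtr_ge0// normal_pdf_ub.
clearbody C.
have F_le' n : `|F n.+1%:R - F (- n.+1%:R)| <= 2 * C * harmonic n.
  have := F_le n.+1%:R; have := F_le (- n.+1%:R); rewrite normrN ger0_norm//.
  have n0 : (0 : R) < n.+1%:R by [].
  rewrite /harmonic /= ler_pdivlMr// => h1 h2.
  apply: le_trans (ler_wpM2r (ltW n0) (ler_normB _ _)) _; nra.
have cvg0 : (\int[mu]_(x in D n) (f x)%:E)%E @[n --> \oo] --> 0%:E.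
  under eq_fun do rewrite FTC.
  apply: cvg_EFin; first exact: nearW.
  apply: norm_cvg0; apply: (@squeeze_cvgr _ _ _ _ (cst 0) (fun n => 2 * C * harmonic n)).
  - by apply: nearW => n; rewrite normr_ge0 F_le'.
  - exact: cvg_cst.
  - rewrite -[X in _ --> X](mulr0 (2 * C)); apply: cvgM; first exact: cvg_cst.
    exact: cvg_harmonic.
have : \int[mu]_x f x = 0 by rewrite /Rintegral (cvg_unique _ cvgf cvg0).
rewrite RintegralB// RintegralZl//= => /eqP.
by rewrite subr_eq0 => /eqP ->.
Unshelve. all: by end_near. Qed.

(** Stein's identity turns the derivative into psi' = - a psi, so exp (b^2 / 2) psi b is constant,
    equal to its value 1 at b = 0. *)
Lemma Rintegral_cos_normal_prob (a : R) :
  \int[gamma]_x cos (a * x) = expR (- (a ^+ 2) / 2).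
Proof.
rewrite Rintegral_normal_prob; last first.
  by apply: integrable_bounded (fun x => cos_max _); exact: measurableT_comp.
rewrite -/(psi a).
have h1 (b : R) : is_derive b 1 (fun b : R => expR (b ^+ 2 / 2) * psi b) 0.
  have e1 : is_derive b 1 (fun b : R => b ^+ 2 / 2) b.
    have := @is_deriveM _ R^o (id ^+ 2) (cst 2^-1) b 1 _ 0 (is_deriveX 2 (is_derive_id _ _)) (is_derive_cst _ _ _).
    rewrite scaler0 add0r => h; apply: is_derive_eq h _.
    rewrite -[LHS]/(2^-1 * (2%:R * b ^+ 1 * 1)); by field.
  have e2 : is_derive b 1 (fun b : R => expR (b ^+ 2 / 2)) (expR (b ^+ 2 / 2) * b).
    exact: (is_derive1_comp (f := expR) (g := fun b : R => b ^+ 2 / 2)).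
  have := @is_deriveM _ R^o _ _ b 1 _ _ e2 (is_derive_psi b).
  move=> h; apply: is_derive_eq h _.
  rewrite psi_parts -[LHS]/(_ * _ + _ * _); ring.
have h2 := is_derive_0_is_cst a 0 h1.
have p0 : psi 0 = 1.
  rewrite /psi; under eq_Rintegral do rewrite mul0r cos0 mul1r.
  by rewrite /Rintegral integral_normal_pdf.
move: h2; rewrite p0 expr0n/= mul0r expR0 mulr1 => h2.
rewrite mulNr expRN; apply: (mulfI (lt0r_neq0 (expR_gt0 (a ^+ 2 / 2)))).
by rewrite h2 divff// gt_eqF// expR_gt0.
Qed.
End gaussian.

(** * Bounded measurable functions under a probability measure *)

Section bounded_measurable.
Context {R : realType} {d : measure_display} {T : measurableType d}.

(** This class is stable under sums, products and composition with measurable maps, and integrable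
    under every probability: all integrability conditions below reduce to it. *)
Definition bounded_mfun (f : T -> R) :=
  measurable_fun setT f /\ exists M, forall x, `|f x| <= M.

Lemma bounded_mfun_integrable (P : probability T R) f :
  bounded_mfun f -> P.-integrable setT (EFin \o f).
Proof. by move=> [mf [M fM]]; exact: integrable_bounded mf fM. Qed.

Lemma bounded_mfun_cst (c : R) : bounded_mfun (fun=> c).
Proof. by split; [exact: measurable_cst|exists `|c|]. Qed.

Lemma bounded_mfunD f g : bounded_mfun f -> bounded_mfun g ->
  bounded_mfun (fun x => f x + g x).
Proof.
move=> [mf [M fM]] [mg [N gN]]; split; first exact: measurable_funD.
by exists (M + N) => x; rewrite (le_trans (ler_normD _ _))// lerD.
Qed.

Lemma bounded_mfunM f g : bounded_mfun f -> bounded_mfun g ->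
  bounded_mfun (fun x => f x * g x).
Proof.
move=> [mf [M fM]] [mg [N gN]]; split; first exact: measurable_funM.
by exists (M * N) => x; rewrite normrM ler_pM.
Qed.

Lemma bounded_mfunZ c f : bounded_mfun f -> bounded_mfun (fun x => c * f x).
Proof. by move=> bf; apply: bounded_mfunM => //; exact: bounded_mfun_cst. Qed.

Lemma bounded_mfun_sum (I : Type) (s : seq I) (F : I -> T -> R) :
  (forall i, bounded_mfun (F i)) -> bounded_mfun (fun x => \sum_(i <- s) F i x).
Proof.
move=> bF; elim: s => [|i s ih].
  by under eq_fun do rewrite big_nil; exact: bounded_mfun_cst.
by under eq_fun do rewrite big_cons; exact: bounded_mfunD.
Qed.

Lemma Rintegral_bounded_sum (P : probability T R) (I : Type) (s : seq I)
    (F : I -> T -> R) : (forall i, bounded_mfun (F i)) ->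
  \int[P]_x (\sum_(i <- s) F i x) = \sum_(i <- s) \int[P]_x F i x.
Proof.
move=> bF; elim: s => [|i s ih].
  rewrite big_nil; under eq_Rintegral do rewrite big_nil.
  by rewrite Rintegral_cst// mul0r.
rewrite big_cons; under eq_Rintegral do rewrite big_cons.
rewrite RintegralD ?ih//; first exact: bounded_mfun_integrable.
by apply: bounded_mfun_integrable; exact: bounded_mfun_sum.
Qed.

Lemma Rintegral_boundedZ (P : probability T R) c f : bounded_mfun f ->
  \int[P]_x (c * f x) = c * \int[P]_x f x.
Proof. by move=> bf; rewrite RintegralZl//; exact: bounded_mfun_integrable. Qed.

Lemma Rintegral_boundedD (P : probability T R) f g :
  bounded_mfun f -> bounded_mfun g ->
  \int[P]_x (f x + g x) = \int[P]_x f x + \int[P]_x g x.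
Proof.
by move=> bf bg; rewrite RintegralD//; exact: bounded_mfun_integrable.
Qed.

Lemma cvg_Rintegral_bounded (P : probability T R) (f_ : nat -> T -> R)
    (f : T -> R) (M : R) :
  (forall n, measurable_fun setT (f_ n)) -> measurable_fun setT f ->
  (forall n x, `|f_ n x| <= M) -> (forall x, f_ n x @[n --> \oo] --> f x) ->
  \int[P]_x f_ n x @[n --> \oo] --> \int[P]_x f x.
Proof.
move=> mf_ mf fM ff.
have [] := @dominated_convergence _ _ _ P setT measurableT
  (fun n => EFin \o f_ n) (EFin \o f) (EFin \o cst M).
- by move=> n; exact/measurable_EFinP.
- exact/measurable_EFinP.
- by apply: aeW => x _; apply: cvg_EFin; [exact: nearW|exact: ff].
- by apply: bounded_mfun_integrable; exact: bounded_mfun_cst.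
- by apply: aeW => x n _; rewrite /= lee_fin.
move=> intf _ h; apply: fine_cvg; rewrite fineK//.
exact: integrable_fin_num.
Qed.

End bounded_measurable.

Lemma bounded_mfun_comp {R : realType} {d : measure_display}
    {T : measurableType d} (f : R -> R) (X : T -> R) :
  bounded_mfun f -> measurable_fun setT X -> bounded_mfun (fun x => f (X x)).
Proof.
move=> [mf [M fM]] mX; split; first exact: measurableT_comp.
by exists M.
Qed.

Lemma bounded_mfun_cos {R : realType} : bounded_mfun (@cos R).
Proof.
split; last by exists 1 => x; exact: cos_max.
by apply: continuous_measurable_fun; exact: continuous_cos.
Qed.

Lemma bounded_mfun_cosM {R : realType} (a : R) :
  bounded_mfun (fun x : R => cos (a * x)).
Proof.
apply: bounded_mfun_comp; first exact: bounded_mfun_cos.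
exact: measurable_funM.
Qed.

(** * Standard Gaussian pairs and their cosine moments *)

Section gaussian_law.
Context {R : realType} {d : measure_display} {T : measurableType d}.
Variable P : probability T R.
Local Notation gamma := (@normal_prob R 0 1).

Lemma Rintegral_law_gauss1 (W : T -> R) (f : R -> R) :
  measurable_fun setT W ->
  (forall B, measurable B -> P [set x | B (W x)] = gauss_law 0 1 B) ->
  bounded_mfun f -> \int[P]_x f (W x) = \int[gamma]_x f x.
Proof.
move=> mW law bf; rewrite /Rintegral; congr fine.
have mW' : measurable_fun setT (W : T -> measurableTypeR R) := mW.
pose W' : {mfun T >-> measurableTypeR R} := HB.pack W (isMeasurableFun.Build _ _ _ _ _ mW').
rewrite -[LHS](@integral_pushforward _ _ _ _ _ _ mW' P setT (EFin \o f))//.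
- apply: (@eq_measure_integral _ _ _ setT gamma (distribution P W')) => A mA _.
  by rewrite -[LHS]/(P [set x | A (W x)]) law// /gauss_law oner_eq0 sqrtr1.
- by apply/measurable_EFinP; case: bf.
- by rewrite preimage_setT; apply: bounded_mfun_integrable; exact: bounded_mfun_comp.
Qed.

(** The degenerate law is a Dirac mass at 0; it occurs for a combination of variance zero, which is
    possible when the correlation is 1 or -1. *)
Lemma Rintegral_law_gauss0 (W : T -> R) (f : R -> R) :
  measurable_fun setT W ->
  (forall B, measurable B -> P [set x | B (W x)] = gauss_law 0 0 B) ->
  bounded_mfun f -> \int[P]_x f (W x) = f 0.
Proof.
move=> mW law bf; rewrite /Rintegral.
have mW' : measurable_fun setT (W : T -> measurableTypeR R) := mW.
pose W' : {mfun T >-> measurableTypeR R} := HB.pack W (isMeasurableFun.Build _ _ _ _ _ mW').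
rewrite -[X in fine X](@integral_pushforward _ _ _ _ _ _ mW' P setT (EFin \o f))//.
- rewrite (@eq_measure_integral _ _ _ setT \d_(0 : measurableTypeR R) (distribution P W')).
    rewrite integral_dirac//; last by apply/measurable_EFinP; case: bf.
    by rewrite diracT mul1e.
  move=> A mA _.
  by rewrite -[LHS]/(P [set x | A (W x)]) law// /gauss_law eqxx.
- by apply/measurable_EFinP; case: bf.
- by rewrite preimage_setT; apply: bounded_mfun_integrable; exact: bounded_mfun_comp.
Qed.

(** Joint normality through the laws of all linear combinations, in the same style as
    [is_gaussian_vector]. Correlations of modulus 1 are allowed, so that the pair (X, X)
    qualifies. *)
Definition std_gaussian_pair (X Y : T -> R) (rho : R) :=
  [/\ measurable_fun setT X, measurable_fun setT Y, `|rho| <= 1 &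
   forall (a b : R) B, measurable B ->
    P [set x | B (a * X x + b * Y x)] =
    gauss_law 0 (a ^+ 2 + b ^+ 2 + 2 * a * b * rho) B].

(** Lets a second moment be computed as a mixed moment at correlation 1. *)
Lemma std_gaussian_pair_diag X Y rho :
  std_gaussian_pair X Y rho -> std_gaussian_pair X X 1.
Proof.
move=> [mX mY _ h]; split; [exact: mX|exact: mX|by rewrite normr1|].
move=> a b B mB; have := h (a + b) 0 B mB.
rewrite (_ : [set x | B ((a + b) * X x + 0 * Y x)] = [set x | B (a * X x + b * X x)]).
  move=> ->; congr gauss_law; ring.
by apply/seteqP; split=> x /=; rewrite mul0r addr0 mulrDl.
Qed.

Variables (X Y : T -> R) (rho : R).
Hypothesis XY : std_gaussian_pair X Y rho.

Lemma std_gaussian_pair_law f : bounded_mfun f ->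
  \int[P]_x f (X x) = \int[gamma]_x f x.
Proof.
move=> bf; have [mX mY _ h] := XY; apply: Rintegral_law_gauss1 => //.
move=> B mB; have := h 1 0 B mB.
rewrite (_ : [set x | B (1 * X x + 0 * Y x)] = [set x | B (X x)]).
  move=> ->; congr gauss_law; ring.
by apply/seteqP; split=> x /=; rewrite mul0r addr0 mul1r.
Qed.

Lemma std_gaussian_pair_var_ge0 (a b : R) :
  0 <= a ^+ 2 + b ^+ 2 + 2 * a * b * rho.
Proof.
have [_ _ + _] := XY; rewrite ler_norml => /andP[r1 r2].
have [ab|ab] := leP 0 (a * b).
  by have := sqr_ge0 (a - b); nra.
by have := sqr_ge0 (a + b); nra.
Qed.

(** If the variance v of the combination is positive, division by its square root reduces to the
    standard law; if v = 0 the combination has the Dirac law at 0. *)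
Lemma Rintegral_cos_pair (a b : R) :
  \int[P]_x cos (a * X x + b * Y x) =
  expR (- (a ^+ 2 + b ^+ 2 + 2 * a * b * rho) / 2).
Proof.
have [mX mY _ h] := XY.
have mZ a' b' : measurable_fun setT (fun x => a' * X x + b' * Y x).
  by apply: measurable_funD; exact: measurable_funM.
have := std_gaussian_pair_var_ge0 a b.
set v := _ + _ + _; rewrite le_eqVlt => /predU1P[v0|v0].
  rewrite -v0 oppr0 mul0r expR0.
  have := @Rintegral_law_gauss0 (fun x => a * X x + b * Y x) _ (mZ a b) _ bounded_mfun_cos.
  rewrite cos0.
  apply => B mB; have := h a b B mB.
  rewrite (esym v0 : a ^+ 2 + b ^+ 2 + 2 * a * b * rho = 0).
  by apply.
pose r := Num.sqrt v.
have r0 : 0 < r by rewrite sqrtr_gt0.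
have rr : r ^+ 2 = v by rewrite sqr_sqrtr// ltW.
rewrite -rr -Rintegral_cos_normal_prob.
rewrite -(@Rintegral_law_gauss1 (fun x => (a / r) * X x + (b / r) * Y x)) //.
- apply: eq_Rintegral => x _; congr cos; field; exact: lt0r_neq0.
- move=> B mB; rewrite (h _ _ _ mB).
  have e : (a / r) ^+ 2 + (b / r) ^+ 2 + 2 * (a / r) * (b / r) * rho = 1.
    apply: (mulIf (lt0r_neq0 v0)); rewrite mul1r -{1}rr /v; field; exact: lt0r_neq0.
  by rewrite e.
- exact: bounded_mfun_cosM.
Qed.

(** Product-to-sum formula: the cross terms of opposite signs combine into cosh (rho a b). *)
Lemma Rintegral_cosM_pair (a b : R) :
  \int[P]_x (cos (a * X x) * cos (b * Y x)) =
  expR (- a ^+ 2 / 2) * expR (- b ^+ 2 / 2) *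
  ((expR (rho * (a * b)) + expR (- (rho * (a * b)))) / 2).
Proof.
have [mX mY _ _] := XY.
have bcos b' : bounded_mfun (fun x => cos (a * X x + b' * Y x)).
  apply: bounded_mfun_comp; first exact: bounded_mfun_cos.
  by apply: measurable_funD; exact: measurable_funM.
transitivity (\int[P]_x (2^-1 * (cos (a * X x + b * Y x) + cos (a * X x + (- b) * Y x)))).
  by apply: eq_Rintegral => x _; rewrite mulNr !cosD cosN sinN; field.
rewrite Rintegral_boundedZ; last exact: bounded_mfunD.
rewrite Rintegral_boundedD// !Rintegral_cos_pair mulrC mulrA; congr (_ / _).
rewrite [RHS]mulrDr -!expRD [RHS]addrC; congr (expR _ + expR _); by field.
Qed.

End gaussian_law.

(** * Comparison of the quadratic forms with kernel cosh - 1 *)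

Section covariance_kernel.
Context {R : realType}.

Lemma cvgr_sum_seq (I : Type) (s : seq I) (F : I -> nat -> R) (l : I -> R) :
  (forall i, F i n @[n --> \oo] --> l i) ->
  (\sum_(i <- s) F i n) @[n --> \oo] --> \sum_(i <- s) l i.
Proof.
move=> Fl; elim: s => [|i s ih].
  by under eq_fun do rewrite big_nil; rewrite big_nil; exact: cvg_cst.
by under eq_fun do rewrite big_cons; rewrite big_cons; exact: cvgD.
Qed.

(** Taylor coefficients of cosh: 1 / j! for even j and 0 for odd j. *)
Let e (j : nat) : R := (1 + (-1) ^+ j) / 2 / j`!%:R.

Let e_ge0 j : 0 <= e j.
Proof.
rewrite !mulr_ge0 ?invr_ge0//.
by rewrite -signr_odd; case: (odd j); rewrite ?expr0 ?expr1; lra.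
Qed.

(** Partial sums of the power series of cosh t - 1; subtracting 1 removes the term j = 0, hence the
    lower index 1. *)
Let cosh_series (t : R) n :
  (series (exp_coeff t) n.+1 + series (exp_coeff (- t)) n.+1) / 2 - 1 =
  \sum_(1 <= j < n.+1) e j * t ^+ j.
Proof.
rewrite /series/= ![in LHS]big_nat_recl//= big_add1/=.
rewrite /exp_coeff /= !expr0 fact0 divr1.
set A := \sum_(0 <= i < n) _; set B := \sum_(0 <= i < n) _.
rewrite (_ : _ / 2 - 1 = (A + B) / 2); last by field.
rewrite -big_split/= mulr_suml; apply: eq_bigr => j _.
rewrite /e (exprNn t).
have : j.+1`!%:R != 0 :> R by rewrite pnatr_eq0 -lt0n fact_gt0.
move: (j.+1`!%:R) ((-1) ^+ j.+1) (t ^+ j.+1) => F a b F0; by field.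
Qed.

(** A kernel that is a power of a product has rank one, so each degree contributes a square. *)
Let gram_sum (s : seq (R * R)) (c : nat -> R) n :
  \sum_(p <- s) \sum_(q <- s) p.1 * q.1 *
    (\sum_(1 <= j < n) c j * (p.2 * q.2) ^+ j) =
  \sum_(1 <= j < n) c j * (\sum_(p <- s) p.1 * p.2 ^+ j) ^+ 2.
Proof.
under eq_bigr => p _ do under eq_bigr => q _ do rewrite mulr_sumr.
under eq_bigr => p _ do rewrite exchange_big/=.
rewrite exchange_big/=; apply: eq_bigr => j _.
rewrite expr2 mulr_suml mulr_sumr; apply: eq_bigr => p _.
rewrite mulr_sumr mulr_sumr; apply: eq_bigr => q _.
by rewrite exprMn; ring.
Qed.

(** Expanding cosh, both sides are series of squares with nonnegative coefficients; the left one
    carries the factors rho^j, and only even j >= 2 occur, for which rho^j <= rho^2. The comparison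
    is made on partial sums and passes to the limit. *)
Lemma cosh_kernel_le (rho : R) (s : seq (R * R)) : `|rho| <= 1 ->
  \sum_(p <- s) \sum_(q <- s) p.1 * q.1 *
    ((expR (rho * (p.2 * q.2)) + expR (- (rho * (p.2 * q.2)))) / 2 - 1) <=
  rho ^+ 2 * \sum_(p <- s) \sum_(q <- s) p.1 * q.1 *
    ((expR (p.2 * q.2) + expR (- (p.2 * q.2))) / 2 - 1).
Proof.
move=> r1.
pose S (t : R) n := (series (exp_coeff t) n.+1 + series (exp_coeff (- t)) n.+1) / 2 - 1.
have S_cvg t : S t n @[n --> \oo] --> (expR t + expR (- t)) / 2 - 1.
  have h u : series (exp_coeff u) n.+1 @[n --> \oo] --> expR u.
    have := is_cvg_series_exp_coeff u.
    by rewrite -(cvg_shiftS (series (exp_coeff u))).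
  apply: cvgB; last exact: cvg_cst.
  by apply: cvgM; [apply: cvgD; exact: h|exact: cvg_cst].
have G_cvg r : (\sum_(p <- s) \sum_(q <- s) p.1 * q.1 * S (r * (p.2 * q.2)) n)
    @[n --> \oo] --> \sum_(p <- s) \sum_(q <- s) p.1 * q.1 *
    ((expR (r * (p.2 * q.2)) + expR (- (r * (p.2 * q.2)))) / 2 - 1).
  apply: cvgr_sum_seq => p; apply: cvgr_sum_seq => q.
  by apply: cvgM; [exact: cvg_cst|exact: S_cvg].
have GE r n : \sum_(p <- s) \sum_(q <- s) p.1 * q.1 * S (r * (p.2 * q.2)) n =
    \sum_(1 <= j < n.+1) (r ^+ j * e j) * (\sum_(p <- s) p.1 * p.2 ^+ j) ^+ 2.
  rewrite -gram_sum; apply: eq_bigr => p _; apply: eq_bigr => q _.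
  rewrite /S cosh_series; congr (_ * _); apply: eq_bigr => j _.
  by rewrite exprMn; ring.
have -> : \sum_(p <- s) \sum_(q <- s) p.1 * q.1 *
    ((expR (p.2 * q.2) + expR (- (p.2 * q.2))) / 2 - 1) =
  \sum_(p <- s) \sum_(q <- s) p.1 * q.1 *
    ((expR (1 * (p.2 * q.2)) + expR (- (1 * (p.2 * q.2)))) / 2 - 1).
  by apply: eq_bigr => p _; apply: eq_bigr => q _; rewrite mul1r.
apply: (ler_cvg_to (G_cvg rho) (cvgM (cvg_cst (rho ^+ 2)) (G_cvg 1))).
apply: nearW => n; rewrite -[leRHS]/(rho ^+ 2 * _) !GE.
rewrite mulr_sumr !big_nat; apply: ler_sum => j /andP[j1 _].
rewrite mulrA ler_wpM2r ?sqr_ge0// expr1n mul1r.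
have [oj|ej] := boolP (odd j).
  have -> : e j = 0 by rewrite /e -signr_odd oj expr1 addrN !mul0r.
  by rewrite !mulr0.
(* For even j >= 2, rho^j is a positive power of rho^2, which lies in [0, 1]. *)
rewrite ler_wpM2r// -[j]odd_double_half (negbTE ej) add0n -mul2n exprM.
have j2 : (0 < j./2)%N by rewrite half_gt0; case: j ej j1 => [|[|]].
rewrite -(prednK j2) exprS ler_piMr ?sqr_ge0//.
by rewrite exprn_ile1 ?sqr_ge0// -real_normK ?num_real// exprn_ile1.
Qed.

End covariance_kernel.

(** * Covariance inequality for even trigonometric polynomials and their limits *)

Section trig_polynomials.
Context {R : realType}.
Local Notation gamma := (@normal_prob R 0 1).

(** The pairs are (amplitude, frequency), with arbitrary real frequencies; using cosines only makes
    the function even. *)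
Definition trig_poly (s : seq (R * R)) (x : R) : R :=
  \sum_(p <- s) p.1 * cos (p.2 * x).

Lemma bounded_mfun_trig_poly s : bounded_mfun (trig_poly s).
Proof.
apply: bounded_mfun_sum => p; apply: bounded_mfunZ; exact: bounded_mfun_cosM.
Qed.

Lemma Rintegral_trig_poly s :
  \int[gamma]_x trig_poly s x = \sum_(p <- s) p.1 * expR (- p.2 ^+ 2 / 2).
Proof.
rewrite Rintegral_bounded_sum; last first.
  by move=> p; apply: bounded_mfunZ; exact: bounded_mfun_cosM.
apply: eq_bigr => p _; rewrite Rintegral_boundedZ; last exact: bounded_mfun_cosM.
by rewrite Rintegral_cos_normal_prob.
Qed.

End trig_polynomials.

Lemma Rintegral_trig_polyM {R : realType} {d : measure_display}
    {T : measurableType d} (P : probability T R) (X Y : T -> R) (rho : R) s :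
  std_gaussian_pair P X Y rho ->
  \int[P]_x (trig_poly s (X x) * trig_poly s (Y x)) =
  \sum_(p <- s) \sum_(q <- s) (p.1 * expR (- p.2 ^+ 2 / 2)) *
    (q.1 * expR (- q.2 ^+ 2 / 2)) *
    ((expR (rho * (p.2 * q.2)) + expR (- (rho * (p.2 * q.2)))) / 2).
Proof.
move=> XY; have [mX mY _ _] := XY.
have bc (p q : R * R) : bounded_mfun (fun x => cos (p.2 * X x) * cos (q.2 * Y x)).
  by apply: bounded_mfunM; apply: (bounded_mfun_comp _ _ (bounded_mfun_cosM _)).
transitivity (\int[P]_x \sum_(p <- s) \sum_(q <- s)
    (p.1 * q.1) * (cos (p.2 * X x) * cos (q.2 * Y x))).
  apply: eq_Rintegral => x _; rewrite /trig_poly mulr_suml.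
  by apply: eq_bigr => p _; rewrite mulr_sumr; apply: eq_bigr => q _; ring.
rewrite Rintegral_bounded_sum; last first.
  by move=> p; apply: bounded_mfun_sum => q; exact: bounded_mfunZ.
apply: eq_bigr => p _; rewrite Rintegral_bounded_sum; last first.
  by move=> q; exact: bounded_mfunZ.
apply: eq_bigr => q _; rewrite Rintegral_boundedZ// (Rintegral_cosM_pair _ _ _ _ XY).
by ring.
Qed.

Section covariance.
Context {R : realType} {d : measure_display} {T : measurableType d}.
Variables (P : probability T R) (X Y : T -> R) (rho : R).
Hypothesis XY : std_gaussian_pair P X Y rho.
Local Notation gamma := (@normal_prob R 0 1).

(** The bound cov (f X, f Y) <= rho^2 Var f, with the means written under [gamma], the common law of
    X and Y. *)
Definition covariance_contracts (f : R -> R) :=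
  \int[P]_x (f (X x) * f (Y x)) - (\int[gamma]_x f x) ^+ 2 <=
  rho ^+ 2 * (\int[gamma]_x (f x ^+ 2) - (\int[gamma]_x f x) ^+ 2).

(* In the Hermite basis both sides are diagonal with nonnegative coefficients, and an even function has no term of degree one: hence the factor rho ^+ 2. *)
Lemma covariance_contracts_trig_poly s :
  covariance_contracts (trig_poly s).
Proof.
have r1 : `|rho| <= 1 by case: XY.
have XX := std_gaussian_pair_diag _ _ _ _ XY.
rewrite /covariance_contracts (Rintegral_trig_polyM _ _ _ _ _ XY).
have -> : \int[gamma]_x (trig_poly s x ^+ 2) =
    \int[P]_x (trig_poly s (X x) * trig_poly s (X x)).
  rewrite (std_gaussian_pair_law _ _ _ _ XY (fun x => trig_poly s x * trig_poly s x))//.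
  by apply: bounded_mfunM; exact: bounded_mfun_trig_poly.
rewrite (Rintegral_trig_polyM _ _ _ _ _ XX) Rintegral_trig_poly.
(* The new amplitudes absorb the Gaussian factors, so that subtracting the squared mean replaces the
   kernel cosh by cosh - 1. *)
pose s' := [seq (p.1 * expR (- p.2 ^+ 2 / 2), p.2) | p <- s].
have := cosh_kernel_le rho s' r1.
have E (c : R) : \sum_(p <- s) \sum_(q <- s) (p.1 * expR (- p.2 ^+ 2 / 2)) *
    (q.1 * expR (- q.2 ^+ 2 / 2)) *
    ((expR (c * (p.2 * q.2)) + expR (- (c * (p.2 * q.2)))) / 2) -
    (\sum_(p <- s) p.1 * expR (- p.2 ^+ 2 / 2)) ^+ 2 =
    \sum_(p <- s') \sum_(q <- s') p.1 * q.1 *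
    ((expR (c * (p.2 * q.2)) + expR (- (c * (p.2 * q.2)))) / 2 - 1).
  rewrite expr2 mulr_suml -sumrB /s' big_map; apply: eq_bigr => p _.
  rewrite mulr_sumr -sumrB big_map; apply: eq_bigr => q _ /=; ring.
rewrite !E; have -> // : \sum_(p <- s') \sum_(q <- s') p.1 * q.1 *
    ((expR (1 * (p.2 * q.2)) + expR (- (1 * (p.2 * q.2)))) / 2 - 1) =
  \sum_(p <- s') \sum_(q <- s') p.1 * q.1 *
    ((expR (p.2 * q.2) + expR (- (p.2 * q.2))) / 2 - 1).
by apply: eq_bigr => p _; apply: eq_bigr => q _; rewrite mul1r.
Qed.

(** Each of the three integrals converges by dominated convergence, with constant majorants. *)
Lemma covariance_contracts_cvg (f_ : nat -> R -> R) (f : R -> R) (M : R) :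
  (forall n, measurable_fun setT (f_ n)) ->
  (forall n x, `|f_ n x| <= M) ->
  (forall x, f_ n x @[n --> \oo] --> f x) ->
  (forall n, covariance_contracts (f_ n)) ->
  measurable_fun setT f /\ covariance_contracts f.
Proof.
move=> mf_ fM ff cf; have [mX mY _ _] := XY.
have mf : measurable_fun setT f.
  by apply: (measurable_fun_cvg mf_) => x _; exact: ff.
split=> //; rewrite /covariance_contracts.
have c1 : \int[gamma]_x f_ n x @[n --> \oo] --> \int[gamma]_x f x.
  exact: (@cvg_Rintegral_bounded _ _ (measurableTypeR R) gamma _ _ M mf_ mf fM ff).
have M0 : 0 <= M by exact: le_trans (fM 0%N 0).
have fM2 n x y : `|f_ n x * f_ n y| <= M * M by rewrite normrM ler_pM.
have c2 : \int[gamma]_x (f_ n x ^+ 2) @[n --> \oo] --> \int[gamma]_x (f x ^+ 2).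
  apply: (@cvg_Rintegral_bounded _ _ (measurableTypeR R) gamma _ _ _ _ _ (fun n x => fM2 n x x)) => [n||x].
  - exact: (measurable_funX 2 (mf_ n)).
  - exact: (measurable_funX 2 mf).
  - by apply: cvgM; exact: ff.
have c3 : \int[P]_x (f_ n (X x) * f_ n (Y x)) @[n --> \oo] -->
    \int[P]_x (f (X x) * f (Y x)).
  apply: (cvg_Rintegral_bounded _ _ _ _ _ _ (fun n x => fM2 n (X x) (Y x))) => [n||x].
  - by apply: measurable_funM; exact: measurableT_comp.
  - by apply: measurable_funM; exact: measurableT_comp.
  - by apply: cvgM; exact: ff.
apply: (ler_cvg_to (cvgB c3 (cvgM c1 c1))
   (cvgM (cvg_cst (rho ^+ 2)) (cvgB c2 (cvgM c1 c1)))).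
by apply: nearW => n; exact: cf.
Qed.

End covariance.

(** * Approximation of a step function by polynomials *)

Section step_limit.
Context {R : realType}.

Lemma bernoulli_ineq (t : R) n : 0 <= t <= 1 -> 1 - n%:R * t <= (1 - t) ^+ n.
Proof.
move=> /andP[t0 t1]; elim: n => [|n ih]; first by rewrite mul0r subr0 expr0.
rewrite exprS -natr1.
apply: le_trans (ler_wpM2l _ ih); last by rewrite subr_ge0.
have := mulr_ge0 (ler0n R n) (mulr_ge0 t0 t0); lra.
Qed.

(** Counterpart of Bernoulli's inequality, by induction from (1 - t) (1 + (n+1) t) <= 1 + n t. *)
Lemma onem_exp_bound (t : R) n : 0 <= t <= 1 -> (1 - t) ^+ n * (1 + n%:R * t) <= 1.
Proof.
move=> /andP[t0 t1]; elim: n => [|n ih]; first by rewrite mul0r addr0 expr0 mul1r.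
apply: le_trans ih; rewrite exprSr -mulrA ler_wpM2l ?exprn_ge0 ?subr_ge0//.
rewrite -natr1; have := mulr_ge0 (ler0n R n) (mulr_ge0 t0 t0); nra.
Qed.

(** 1 - r^n is (1 - r) times a geometric sum of n terms, each at least r^n. *)
Lemma natr_expr_bound (r : R) n : 0 <= r <= 1 -> n%:R * (1 - r) * r ^+ n <= 1 - r ^+ n.
Proof.
move=> /andP[r0 r1]; elim: n => [|n ih]; first by rewrite !mul0r expr0 subrr.
have p0 : 0 <= r ^+ n by exact: exprn_ge0.
have p1 : r ^+ n <= 1 by exact: exprn_ile1.
rewrite exprS -natr1; move: (n%:R : R) (r ^+ n) p0 p1 ih => m p p0 p1 ih.
have h1 := ler_wpM2l r0 ih.
have h2 : 0 <= (1 - r) * (1 - r * p).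
  by rewrite mulr_ge0 ?subr_ge0// mulr_ile1.
lra.
Qed.

(** With q = r^2, one factor r^n controls n and the other one tends to 0. *)
Lemma cvg_natr_expr (q : R) : 0 <= q < 1 -> n%:R * q ^+ n @[n --> \oo] --> 0.
Proof.
move=> /andP[q0 q1]; pose r := Num.sqrt q.
have r0 : 0 <= r by exact: sqrtr_ge0.
have r1 : r < 1 by rewrite -sqrtr1 ltr_sqrt.
have qE : q = r * r by rewrite -expr2 sqr_sqrtr.
apply: (@squeeze_cvgr _ _ _ _ (cst 0) (fun n => (1 - r)^-1 * r ^+ n)).
- apply: nearW => n; rewrite mulr_ge0 ?exprn_ge0//= qE exprMn mulrA.
  rewrite ler_wpM2r ?exprn_ge0// -[(1 - r)^-1]mul1r ler_pdivlMr ?subr_gt0//.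
  have := natr_expr_bound r n; rewrite r0 ltW// => /(_ isT) h.
  rewrite mulrAC (le_trans h)// gerBl exprn_ge0//.
- exact: cvg_cst.
- rewrite -[X in _ --> X](mulr0 (1 - r)^-1).
  apply: cvgM; [exact: cvg_cst|apply: cvg_expr].
  by rewrite ger0_norm.
Qed.

(** Let M be the exponent, about n tau^-n. If y < tau then M y^n <= n (y / tau)^n tends to 0 and
    Bernoulli's inequality gives the limit 1. If y >= tau then M y^n >= n / 2 and the power is at
    most 1 / (1 + M y^n). The extra factor n in M settles the case y = tau. *)
Lemma cvg_step (tau y : R) : 0 < tau < 1 -> 0 <= y <= 1 ->
  (1 - y ^+ n) ^+ (n * Num.truncn (tau^-1 ^+ n)) @[n --> \oo] --> ((y < tau)%R%:R : R).
Proof.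
move=> /andP[tau0 tau1] /andP[y0 y1].
pose N n : R := (Num.truncn (tau^-1 ^+ n))%:R.
have B1 n : 1 <= tau^-1 ^+ n by rewrite exprn_ege1// invf_ge1// ltW.
have [Nle Ngt] : (forall n, N n <= tau^-1 ^+ n) /\ (forall n, tau^-1 ^+ n < N n + 1).
  split=> n; have /truncn_itv/andP[h1 h2] : 0 <= tau^-1 ^+ n.
  - by rewrite exprn_ge0// invr_ge0 ltW.
  - by [].
  - by rewrite exprn_ge0// invr_ge0 ltW.
  - by rewrite /N natr1.
have N1 n : 1 <= N n by rewrite /N ler1n truncn_gt0.
have yn n : 0 <= y ^+ n <= 1 by rewrite exprn_ge0//= exprn_ile1.
have taun n : tau ^+ n * tau^-1 ^+ n = 1.
  by rewrite -exprMn divff ?expr1n// gt_eqF.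
have [yt|ty] := ltP y tau.
- apply: (@squeeze_cvgr _ _ _ _ (fun n => 1 - n%:R * (y / tau) ^+ n) (cst 1)).
  + apply: nearW => n; apply/andP; split; last first.
      by rewrite exprn_ile1 ?subr_ge0 ?gerBl; case/andP: (yn n).
    apply: le_trans (bernoulli_ineq _ _ (yn n)).
    rewrite natrM lerD2l lerN2 -mulrA ler_wpM2l// exprMn mulrC.
    by rewrite ler_wpM2l ?exprn_ge0// Nle.
  + rewrite -[X in _ --> X]subr0; apply: cvgB; first exact: cvg_cst.
    apply: cvg_natr_expr.
    by rewrite divr_ge0 ?(ltW tau0)//= ltr_pdivrMr// mul1r.
  + exact: cvg_cst.
- rewrite -cvg_shiftS.
  apply: (@squeeze_cvgr _ _ _ _ (cst 0) (fun n => 2 * harmonic n)).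
  + apply: nearW => n; apply/andP; split.
      by rewrite exprn_ge0// subr_ge0; case/andP: (yn n.+1).
    rewrite /harmonic/= ler_pdivlMr//.
    have := onem_exp_bound _ (n.+1 * Num.truncn (tau^-1 ^+ n.+1)) (yn n.+1).
    rewrite natrM -/(N n.+1).
    have : 0 <= (1 - y ^+ n.+1) ^+ (n.+1 * Num.truncn (tau^-1 ^+ n.+1)).
      by rewrite exprn_ge0// subr_ge0; case/andP: (yn n.+1).
    set E := _ ^+ (_ * _)%N => E0.
    (* Truncation loses less than 1 and leaves at least 1, hence at least half of tau^-n. *)
    have h : 1 / 2 <= N n.+1 * y ^+ n.+1.
      have ht : tau ^+ n.+1 <= y ^+ n.+1 by rewrite lerXn2r ?nnegrE// ltW.
      have h1 := ler_wpM2l (le_trans ler01 (N1 n.+1)) ht.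
      have tn0 : 0 < tau ^+ n.+1 by rewrite exprn_gt0.
      have h2 : tau^-1 ^+ n.+1 <= 2 * N n.+1 by have := Ngt n.+1; have := N1 n.+1; lra.
      have h3 := ler_wpM2l (ltW tn0) h2.
      rewrite taun in h3; nra.
    move=> h0.
    have h1 : E * (n.+1%:R * (1 / 2)) <= E * (1 + n.+1%:R * N n.+1 * y ^+ n.+1).
      rewrite ler_wpM2l// -mulrA.
      have := ler_wpM2l (ler0n R n.+1) h; lra.
    lra.
  + exact: cvg_cst.
  + rewrite -[X in _ --> X](mulr0 2); apply: cvgM; first exact: cvg_cst.
    exact: cvg_harmonic.
Qed.

End step_limit.

(** * Trigonometric polynomials form an algebra *)

Section trig_poly_algebra.
Context {R : realType}.

Definition is_trig_poly (f : R -> R) := exists s, f = trig_poly s.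

Lemma is_trig_poly_cst c : is_trig_poly (fun=> c).
Proof.
exists [:: (c, 0)]; apply/funext => x.
by rewrite /trig_poly big_seq1 mul0r cos0 mulr1.
Qed.

Lemma is_trig_poly_cos a : is_trig_poly (fun x => cos (a * x)).
Proof.
by exists [:: (1, a)]; apply/funext => x; rewrite /trig_poly big_seq1 mul1r.
Qed.

Lemma is_trig_polyD f g : is_trig_poly f -> is_trig_poly g ->
  is_trig_poly (fun x => f x + g x).
Proof.
move=> [s ->] [t ->]; exists (s ++ t); apply/funext => x.
by rewrite /trig_poly big_cat.
Qed.

Lemma is_trig_polyM f g : is_trig_poly f -> is_trig_poly g ->
  is_trig_poly (fun x => f x * g x).
Proof.
move=> [s ->] [t ->].
exists ([seq (p.1 * q.1 / 2, p.2 + q.2) | p <- s, q <- t] ++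
        [seq (p.1 * q.1 / 2, p.2 - q.2) | p <- s, q <- t]).
apply/funext => x; rewrite /trig_poly big_cat/= !big_allpairs_dep.
rewrite -big_split mulr_suml; apply: eq_bigr => p _ /=.
rewrite -big_split mulr_sumr; apply: eq_bigr => q _ /=.
rewrite mulrDl mulrBl !cosD cosN sinN; by field.
Qed.

Lemma is_trig_polyX f n : is_trig_poly f -> is_trig_poly (fun x => f x ^+ n).
Proof.
move=> tf; elim: n => [|n ih].
  by under eq_fun do rewrite expr0; exact: is_trig_poly_cst.
by under eq_fun do rewrite exprS; exact: is_trig_polyM.
Qed.

End trig_poly_algebra.

Lemma measurable_sqr_le {R : realType} (u : R) :
  measurable [set z : R | z ^+ 2 <= u].
Proof.
rewrite -[X in measurable X]setTI.
have : measurable_fun setT (fun x : R => x ^+ 2) by exact: measurable_funX.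
move=> /(_ measurableT `]-oo, u]%classic (measurable_itv _)).
by congr measurable; apply/seteqP; split => x /=; rewrite in_itv.
Qed.

(** * Covariance inequality for indicators of symmetric segments *)

Section indicator.
Context {R : realType} {d : measure_display} {T : measurableType d}.
Variables (P : probability T R) (X Y : T -> R) (rho : R).
Hypothesis XY : std_gaussian_pair P X Y rho.
Local Notation gamma := (@normal_prob R 0 1).

(** This is sin^2 (a x / 2): a trigonometric polynomial with values in [0, 1], increasing in |x| as
    long as |a x| <= pi. *)
Let y (a x : R) : R := (1 - cos (a * x)) / 2.

Let y01 a x : 0 <= y a x <= 1.
Proof.
have := cos_max (a * x); rewrite ler_norml => /andP[h1 h2].
by rewrite /y; apply/andP; split; lra.
Qed.

(** [cvg_step] composed with [y a] exhibits the periodic indicator as a limit of trigonometric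
    polynomials with values in [0, 1]. *)
Lemma covariance_contracts_periodic (a tau : R) : 0 < tau < 1 ->
  measurable_fun setT (fun x : R => (y a x < tau)%R%:R : R) /\
  covariance_contracts P X Y rho (fun x => (y a x < tau)%R%:R).
Proof.
move=> tau01.
pose f n x := (1 - y a x ^+ n) ^+ (n * Num.truncn (tau^-1 ^+ n)).
have tf n : is_trig_poly (f n).
  apply: is_trig_polyX; apply: is_trig_polyD; first exact: is_trig_poly_cst.
  under eq_fun do rewrite -mulN1r.
  apply: is_trig_polyM; first exact: is_trig_poly_cst.
  apply: is_trig_polyX; apply: is_trig_polyM; last exact: is_trig_poly_cst.
  apply: is_trig_polyD; first exact: is_trig_poly_cst.
  under eq_fun do rewrite -mulN1r.
  apply: is_trig_polyM; first exact: is_trig_poly_cst.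
  exact: is_trig_poly_cos.
apply: (covariance_contracts_cvg _ _ _ _ XY f _ 1).
- by move=> n; have [s ->] := tf n; case: (bounded_mfun_trig_poly s).
- move=> n x; have /andP[h0 h1] := y01 a x.
  have h2 : 0 <= y a x ^+ n by rewrite exprn_ge0.
  have h3 : y a x ^+ n <= 1 by rewrite exprn_ile1.
  by rewrite ger0_norm ?exprn_ge0 ?exprn_ile1 ?subr_ge0 ?gerBl.
- by move=> x; apply: cvg_step.
- by move=> n; have [s ->] := tf n; exact: covariance_contracts_trig_poly.
Qed.

(** A frequency [del n] tending to 0 sends the unwanted periods to infinity. The strict threshold r
    + [del n] decreases to r, so the closed segment appears in the limit. *)
Lemma covariance_contracts_segment (r : R) : 0 <= r ->
  measurable_fun setT (fun x : R => (`|x| <= r)%R%:R : R) /\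
  covariance_contracts P X Y rho (fun x => (`|x| <= r)%R%:R).
Proof.
move=> r0.
(* Shifting the index by J ensures [del n] (r + [del n]) < 1 < pi from n = 0 on, so the threshold
   lies where cos is decreasing. *)
pose J := (Num.truncn r).+2.
have Jr : r + 1 < J%:R by rewrite -natr1 ltrD2r truncnS_gt.
pose del n : R := (n + J)%:R^-1.
have nJ n : (0 : R) < (n + J)%:R by rewrite ltr0n addnS.
have del0 n : 0 < del n by rewrite invr_gt0.
have del1 n : del n <= 1 by rewrite invf_le1// ler1n addnS.
have delr n : del n * (r + del n) < 1.
  rewrite mulrC ltr_pdivrMr// mul1r.
  have : J%:R <= (n + J)%:R :> R by rewrite ler_nat leq_addl.
  have := del1 n; lra.
have pi2 := pi_ge2 R.
pose tau n := y (del n) (r + del n).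
have itv n : del n * (r + del n) \in `[0, pi].
  rewrite in_itv/= mulr_ge0 ?addr_ge0 ?(ltW (del0 n))//=.
  by have := delr n; lra.
have tau01 n : 0 < tau n < 1.
  have c1 : cos (del n * (r + del n)) < 1.
    rewrite -cos0 ltr_cos//; last by rewrite in_itv/= lexx pi_ge0.
    by rewrite mulr_gt0// ltr_wpDl.
  have cm1 : -1 < cos (del n * (r + del n)).
    rewrite -cospi ltr_cos//; last by rewrite in_itv/= lexx pi_ge0.
    by have := delr n; lra.
  rewrite /tau /y; apply/andP; split; lra.
apply: (covariance_contracts_cvg _ _ _ _ XY
  (fun n x => (y (del n) x < tau n)%R%:R) _ 1).
- by move=> n; have [] := covariance_contracts_periodic (del n) _ (tau01 n).
- by move=> n x; case: (_ < _); rewrite ?normr1 ?normr0.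
(* For a fixed x and n large, [del n] |x| <= 1 too, so comparing cosines amounts to comparing |x|
   with r + [del n]. *)
- move=> x; apply: cvg_near_cst; near=> n.
  have dx : del n * `|x| <= 1.
    rewrite mulrC ler_pdivrMr// mul1r.
    near: n; exists (Num.truncn `|x|).+1 => // n /= nx.
    rewrite (le_trans (ltW (truncnS_gt _)))// ler_nat.
    by rewrite (leq_trans nx)// leq_addr.
  have -> : (y (del n) x < tau n) = (`|x| < r + del n).
    have -> : y (del n) x = y (del n) `|x|.
      rewrite /y; have [x0|x0] := leP 0 x; first by rewrite ger0_norm.
      by rewrite ltr0_norm// mulrN cosN.
    rewrite /tau /y ltr_pM2r ?invr_gt0// ltrD2l ltrN2 ltr_cos// ?ltr_pM2l//.
    rewrite in_itv/= mulr_ge0 ?(ltW (del0 n))//=; lra.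
  have [xr|xr] := leP `|x| r.
    by rewrite (le_lt_trans xr)// ltrDl.
  rewrite ltNge (_ : r + del n <= `|x|)//.
  rewrite -lerBrDl -[leRHS]invrK lef_pV2 ?posrE ?invr_gt0 ?subr_gt0//.
  near: n; exists (Num.truncn (`|x| - r)^-1).+1 => // n /= nx.
  rewrite (le_trans (ltW (truncnS_gt _)))// ler_nat.
  by rewrite (leq_trans nx)// leq_addr.
- by move=> n; have [] := covariance_contracts_periodic (del n) _ (tau01 n).
Unshelve. all: by end_near. Qed.

Lemma Rintegral_chi2_1 (u : R) :
  \int[gamma]_x ((x ^+ 2 <= u)%R%:R : R) = chi2_1_cdf u.
Proof.
have mA := measurable_sqr_le u.
rewrite /Rintegral /chi2_1_cdf; congr fine.
rewrite -[X in normal_prob 0 1 X]setIT.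
rewrite -[RHS](integral_indic gamma measurableT mA).
apply: eq_integral => x _; rewrite indicE.
by rewrite (_ : (x \in _) = (x ^+ 2 <= u)%R)//; apply/idP/idP; rewrite inE.
Qed.

Lemma covariance_chi2_1 (u : R) : 0 <= u ->
  \int[P]_x (((X x) ^+ 2 <= u)%R%:R * ((Y x) ^+ 2 <= u)%R%:R) - chi2_1_cdf u ^+ 2 <=
  rho ^+ 2 * (chi2_1_cdf u - chi2_1_cdf u ^+ 2).
Proof.
move=> u0; have [_] := covariance_contracts_segment (Num.sqrt u) (sqrtr_ge0 _).
rewrite /covariance_contracts.
have E x : (`|x| <= Num.sqrt u) = (x ^+ 2 <= u).
  by rewrite -(real_normK (num_real x)) -{2}(sqr_sqrtr u0) ler_sqr ?nnegrE ?sqrtr_ge0.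
under [X in _ <= _ * (X - _) -> _]eq_Rintegral => x _.
  rewrite E (_ : _%:R ^+ 2 = ((x ^+ 2 <= u)%R%:R : R)); last by case: (_ <= u); rewrite ?expr1n ?expr0n.
  over.
under [X in _ - X ^+ 2 <= _]eq_Rintegral do rewrite E.
under [X in _ * (_ - X ^+ 2)]eq_Rintegral do rewrite E.
under [X in X - _ <= _]eq_Rintegral do rewrite !E.
by rewrite Rintegral_chi2_1.
Qed.

End indicator.

(** * Tail, small values and increments of the chi-square c.d.f *)

Section chi2_1.
Context {R : realType}.
Local Notation mu := (@lebesgue_measure R).
Local Notation gamma := (@normal_prob R 0 1).
Local Notation F := (@chi2_1_cdf R).
Local Notation A u := [set z : R | z ^+ 2 <= u].

Lemma EFin_chi2_1_cdf u : (F u)%:E = gamma (A u).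
Proof. by rewrite fineK// fin_num_measure//; exact: measurable_sqr_le. Qed.

Lemma chi2_1_cdf_le1 u : F u <= 1.
Proof.
by rewrite -lee_fin EFin_chi2_1_cdf probability_le1//; exact: measurable_sqr_le.
Qed.

Lemma chi2_1_cdf_nd : {homo F : u v / u <= v}.
Proof.
move=> u v uv; rewrite -lee_fin !EFin_chi2_1_cdf le_measure ?inE//.
- exact: measurable_sqr_le.
- exact: measurable_sqr_le.
- by move=> x /= /le_trans; apply.
Qed.

(** Where z^2 > u, the N(0,1) density is at most sqrt 2 exp (- u / 4) times the N(0,2) density, of
    total mass 1; then exp (u / 4) >= 1 + u^2 / 32. *)
Lemma chi2_1_tail (u : R) : 0 < u -> 1 - F u <= 64 / u ^+ 2.
Proof.
move=> u0; have mA := measurable_sqr_le u.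
have mAC : measurable (~` A u) by exact: measurableC.
have mpdf s : measurable_fun setT (fun x : R => (normal_pdf 0 s x)%:E).
  by apply/measurable_EFinP; exact: measurable_normal_pdf.
have c0 : 0 <= Num.sqrt 2 * expR (- u / 4) :> R by rewrite mulr_ge0 ?sqrtr_ge0 ?expR_ge0.
have h : (gamma (~` A u) <= (Num.sqrt 2 * expR (- u / 4))%:E)%E.
  apply: (@le_trans _ _ (\int[mu]_(x in ~` A u)
     ((Num.sqrt 2 * expR (- u / 4))%:E * (normal_pdf 0 (Num.sqrt 2) x)%:E))%E).
    apply: ge0_le_integral => //.
    - by move=> x _; rewrite lee_fin normal_pdf_ge0.
    - by apply: measurable_funTS; exact: mpdf.
    - by apply: measurable_funeM; apply: measurable_funTS; exact: mpdf.
    - move=> x /= /negP; rewrite -ltNge => xu.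
      rewrite -EFinM lee_fin normal_pdf1_split mulrAC.
      rewrite ler_wpM2r ?normal_pdf_ge0// ler_wpM2l ?sqrtr_ge0// ler_expR.
      by rewrite ler_wpM2r ?invr_ge0// lerN2 ltW.
  rewrite ge0_integralZl//; last 2 first.
  - by apply: measurable_funTS; exact: mpdf.
  - by move=> x _; rewrite lee_fin normal_pdf_ge0.
  - by rewrite -[leRHS]mule1 lee_wpmul2l ?lee_fin// -(integral_normal_pdf 0 (Num.sqrt 2 : R)) ge0_subset_integral//; [exact: mpdf|move=> x _; rewrite lee_fin normal_pdf_ge0].
have : (1 - F u)%:E = gamma (~` A u).
  by rewrite probability_setC// EFinB EFin_chi2_1_cdf.
move=> E; rewrite -E lee_fin in h; apply: le_trans h _.
have s2 : Num.sqrt 2 <= 2 :> R.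
  rewrite -[leRHS]ger0_norm// -sqrtr_sqr ler_wsqrtr//; lra.
have u4 : 0 < u / 4 by rewrite divr_gt0.
have h : 1 + u ^+ 2 / 32 <= expR (u / 4).
  rewrite (_ : u ^+ 2 / 32 = (u / 4) ^+ 2 / 2`!%:R); last by rewrite (_ : 2`! = 2%N)//; field.
  exact: (expR_ge1Dxn 1 (ltW u4)).
have e0 := expR_gt0 (u / 4).
have h2 : expR (- u / 4) <= 32 / u ^+ 2.
  rewrite mulNr expRN -[leLHS]mul1r ler_pdivrMr// mulrC mulrA ler_pdivlMr ?exprn_gt0//.
  lra.
apply: (@le_trans _ _ (2 * (32 / u ^+ 2))); last by lra.
by rewrite ler_pM ?sqrtr_ge0 ?expR_ge0.
Qed.

Lemma normal_peak1_le : normal_peak (1 : R) <= 1 / 2.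
Proof.
rewrite /normal_peak expr1n mul1r div1r lef_pV2 ?posrE//; last first.
  by rewrite sqrtr_gt0 mulrn_wgt0// pi_gt0.
rewrite -[leLHS]ger0_norm// -sqrtr_sqr ler_wsqrtr//.
have := pi_ge2 R; rewrite -mulr_natr; lra.
Qed.

Lemma sqr_leE (u : R) : 0 <= u -> A u = `[- Num.sqrt u, Num.sqrt u]%classic.
Proof.
move=> u0.
have E (x : R) : (x ^+ 2 <= u) = (`|x| <= Num.sqrt u).
  rewrite -(real_normK (num_real x)) -{1}(sqr_sqrtr u0).
  by rewrite ler_sqr ?nnegrE ?sqrtr_ge0.
by apply/seteqP; split=> x /=; rewrite in_itv/= -ler_norml E.
Qed.

(** The interval [-1/4, 1/4] has length 1/2 and the Gaussian density is at most 1/2. *)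
Lemma chi2_1_cdf_small : F (1 / 16) <= 1 / 4.
Proof.
have s : Num.sqrt (1 / 16) = 1 / 4 :> R.
  by rewrite (_ : 1 / 16 = (1 / 4) ^+ 2) ?sqrtr_sqr ?ger0_norm//; field.
rewrite -lee_fin EFin_chi2_1_cdf sqr_leE// s.
apply: (@le_trans _ _ (\int[mu]_(x in `[(- (1 / 4))%R, (1 / 4)%R]) (1 / 2)%:E)%E).
  apply: ge0_le_integral => //.
  - by move=> x _; rewrite lee_fin normal_pdf_ge0.
  - by apply: measurable_funTS; apply/measurable_EFinP; exact: measurable_normal_pdf.
  - move=> x _; rewrite lee_fin (le_trans (normal_pdf_ub _ _ _))//.
    exact: normal_peak1_le.
rewrite integral_cst//= lebesgue_measure_itv/= lte_fin gtrN// -EFinB -EFinM lee_fin; lra.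
Qed.

(** The mass of ]sqrt u, sqrt v] alone suffices: the density there is at least c, and sqrt v - sqrt
    u = (v - u) / (sqrt v + sqrt u) with denominator at most 2 sqrt M. *)
Lemma chi2_1_cdf_increments (M : R) : 0 < M ->
  exists2 k, 0 < k & forall u v, 0 <= u -> u <= v -> v <= M -> k * (v - u) <= F v - F u.
Proof.
move=> M0.
pose c := normal_peak (1 : R) * expR (- M / 2).
have c0 : 0 < c by rewrite mulr_gt0 ?expR_gt0// normal_peak_gt0.
have sM0 : 0 < Num.sqrt M by rewrite sqrtr_gt0.
exists (c / (2 * Num.sqrt M)); first by rewrite divr_gt0// mulr_gt0.
move=> u v u0 uv vM; have v0 := le_trans u0 uv.
set a := Num.sqrt u; set b := Num.sqrt v.
have a0 : 0 <= a by exact: sqrtr_ge0.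
have ab : a <= b by exact: ler_wsqrtr.
have bM : b <= Num.sqrt M by exact: ler_wsqrtr.
have uE : u = a * a by rewrite -expr2 sqr_sqrtr.
have vE : v = b * b by rewrite -expr2 sqr_sqrtr.
have h : c * (b - a) <= F v - F u.
  rewrite lerBrDl -lee_fin EFinD !EFin_chi2_1_cdf.
  have mI : measurable `]a, b]%classic by exact: measurable_itv.
  have h1 : ((c * (b - a))%:E <= gamma `]a, b]%classic)%E.
    apply: (@le_trans _ _ (\int[mu]_(x in `]a, b]) c%:E)%E).
      rewrite integral_cst//= lebesgue_measure_itv/= lte_fin.
      case: ltP => [_|ba]; first by rewrite -EFinB -EFinM.
      by rewrite mule0 lee_fin mulr_ge0_le0 ?(ltW c0)// subr_le0.
    apply: ge0_le_integral => //.
    - by move=> x _; rewrite lee_fin ltW.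
    - by apply: measurable_funTS; apply/measurable_EFinP; exact: measurable_normal_pdf.
    - move=> x /=; rewrite in_itv/= => /andP[ax xb]; rewrite lee_fin.
      rewrite normal_pdfE ?oner_eq0// /c /normal_fun subr0 expr1n.
      rewrite ler_wpM2l ?normal_peak_ge0// ler_expR ler_wpM2r ?invr_ge0// lerN2.
      by apply: le_trans vM; rewrite vE -expr2 lerXn2r ?nnegrE// (le_trans a0)// ltW.
  apply: (@le_trans _ _ (gamma (A u) + gamma `]a, b]%classic)%E).
    by rewrite leeD2l.
  rewrite -measureU//; last 2 first.
  - exact: measurable_sqr_le.
  - rewrite sqr_leE// -/a; apply/seteqP; split=> x //= [].
    by rewrite !in_itv/= => /andP[_ xa] /andP[ax _]; move: (lt_le_trans ax xa); rewrite ltxx.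
  rewrite le_measure ?inE//.
  - by apply: measurableU => //; exact: measurable_sqr_le.
  - exact: measurable_sqr_le.
  - move=> x [] /= h; first exact: le_trans uv.
    move: h; rewrite in_itv/= => /andP[ax xb].
    by rewrite vE -expr2 lerXn2r ?nnegrE// (le_trans a0)// ltW.
apply: le_trans h; rewrite mulrAC ler_pdivrMr ?mulr_gt0//.
rewrite -[leRHS]mulrA ler_wpM2l ?(ltW c0)// uE vE.
have ba : 0 <= b - a by rewrite subr_ge0.
have baM : b + a <= 2 * Num.sqrt M by lra.
have := ler_wpM2l ba baM; lra.
Qed.

End chi2_1.

(** * Variance of the empirical c.d.f. of the normalized noise *)

Section gaussian_vector.
Context {R : realType} {dT : measure_display} {T : measurableType dT}.
Variables (P : probability T R) (d : nat) (Sigma : 'M[R]_d) (eps : T -> 'I_d -> R).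
Hypothesis geps : is_gaussian_vector P Sigma eps.
Hypothesis covS : is_cov_matrix Sigma.
Hypothesis diagS : forall i, 0 < Sigma i i.
Local Notation F := (@chi2_1_cdf R).

Let sd i := Num.sqrt (Sigma i i).
Let sd_gt0 i : 0 < sd i. Proof. by rewrite sqrtr_gt0. Qed.
Let sd_sqr i : sd i * sd i = Sigma i i.
Proof. by rewrite -expr2 sqr_sqrtr// ltW. Qed.

Definition normalized (i : 'I_d) (x : T) : R := eps x i / Num.sqrt (Sigma i i).

(** The coefficient vector a e_i + b e_j; for i = j the two coefficients add up. *)
Let two (i j : 'I_d) (a b : R) (k : 'I_d) : R :=
  a * (k == i)%:R + b * (k == j)%:R.

Let sum_two i j a b (g : 'I_d -> R) : \sum_k two i j a b k * g k = a * g i + b * g j.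
Proof.
have delta c l : \sum_k c * (k == l)%:R * g k = c * g l.
  rewrite (bigD1 l)//= eqxx mulr1 big1 ?addr0// => k /negbTE ->.
  by rewrite mulr0 mul0r.
under eq_bigr do rewrite mulrDl.
by rewrite big_split/= !delta.
Qed.

Let quad_two i j a b :
  \sum_k \sum_l two i j a b k * two i j a b l * Sigma k l =
  a ^+ 2 * Sigma i i + b ^+ 2 * Sigma j j + 2 * a * b * Sigma i j.
Proof.
under eq_bigr => k _.
  under eq_bigr => l _ do rewrite -mulrA.
  rewrite -mulr_sumr sum_two; over.
by rewrite /= sum_two (covS.1 j i); ring.
Qed.

Let quad_std i j a b :
  (a / sd i) ^+ 2 * Sigma i i + (b / sd j) ^+ 2 * Sigma j j +
    2 * (a / sd i) * (b / sd j) * Sigma i j =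
  a ^+ 2 + b ^+ 2 + 2 * a * b * tSigma Sigma i j.
Proof.
rewrite mxE -/(sd i) -/(sd j) -(sd_sqr i) -(sd_sqr j); field.
by rewrite !gt_eqF.
Qed.

(** Positivity of the covariance form on the normalized vectors (1, 1) and (1, -1) reads 2 + 2 rho
    >= 0 and 2 - 2 rho >= 0. *)
Lemma normr_tSigma_le1 i j : `|tSigma Sigma i j| <= 1.
Proof.
have h b : 0 <= 1 ^+ 2 + b ^+ 2 + 2 * 1 * b * tSigma Sigma i j.
  by rewrite -quad_std -quad_two; exact: covS.2.
rewrite ler_norml; have := h 1; have := h (-1).
by rewrite sqrrN expr1n; move=> h1 h2; apply/andP; split; lra.
Qed.

Lemma measurable_normalized i : measurable_fun setT (normalized i).
Proof. by apply: measurable_funM => //; exact: geps.1. Qed.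

Lemma normalized_pair i j :
  std_gaussian_pair P (normalized i) (normalized j) (tSigma Sigma i j).
Proof.
split; [exact: measurable_normalized|exact: measurable_normalized|exact: normr_tSigma_le1|].
move=> a b B mB; have := geps.2 (two i j (a / sd i) (b / sd j)) B mB.
rewrite quad_two quad_std => <-; congr (P _).
apply/seteqP; split=> x /=; rewrite sum_two /normalized -/(sd i) -/(sd j);
  by rewrite mulrAC mulrA (mulrAC b) mulrA.
Qed.

Lemma tSigma_diag i : tSigma Sigma i i = 1.
Proof. by rewrite mxE -/(sd i) sd_sqr divff// gt_eqF. Qed.

(** Built from the noise instead of the observations: the unobserved, uncontaminated counterpart of
    [Fhat]. *)
Definition empirical_cdf (u : R) (x : T) : R :=
  (\sum_i ((normalized i x) ^+ 2 <= u)%R%:R) / d%:R.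

Let f (u z : R) : R := (z ^+ 2 <= u)%R%:R.

Let bounded_f u : bounded_mfun (f u).
Proof.
split; last by exists 1 => x; rewrite /f; case: (x ^+ 2 <= u); rewrite ?normr1 ?normr0.
have -> : f u = \1_[set z | z ^+ 2 <= u].
  apply/funext => z; rewrite indicE /f.
  by rewrite (_ : (z \in _) = (z ^+ 2 <= u)%R)//; apply/idP/idP; rewrite inE.
by apply: measurable_indic; exact: measurable_sqr_le.
Qed.

Lemma bounded_empirical_cdf u : bounded_mfun (empirical_cdf u).
Proof.
apply: bounded_mfunM; last exact: bounded_mfun_cst.
apply: bounded_mfun_sum => i.
by apply: (bounded_mfun_comp (f u) (normalized i)); [exact: bounded_f|exact: measurable_normalized].
Qed.

Let E_f u i : \int[P]_x f u (normalized i x) = F u.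
Proof.
rewrite (std_gaussian_pair_law _ _ _ _ (normalized_pair i i) _ (bounded_f u)).
exact: Rintegral_chi2_1.
Qed.

(** The variance is an average of covariances, each at most rho_ij^2 (F u - F u ^ 2) <= rho_ij^2 (1
    - F u). Keeping the factor 1 - F u gives the decay in u that makes the sum over scales
    converge. *)
Lemma variance_empirical_cdf (u : R) : (0 < d)%N -> 0 <= u ->
  \int[P]_x ((empirical_cdf u x - F u) ^+ 2) <=
  (frob_norm (tSigma Sigma) / d%:R) ^+ 2 * (1 - F u).
Proof.
move=> d0 u0; have dR : (0 : R) < d%:R by rewrite ltr0n.
have bfi i : bounded_mfun (fun x => f u (normalized i x)).
  exact: (bounded_mfun_comp _ _ (bounded_f u) (measurable_normalized i)).
have bfi' i : bounded_mfun (fun x => f u (normalized i x) - F u).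
  by apply: bounded_mfunD => //; exact: bounded_mfun_cst.
have bff i j : bounded_mfun (fun x => f u (normalized i x) * f u (normalized j x)).
  exact: bounded_mfunM.
have Eij i j : \int[P]_x ((f u (normalized i x) - F u) * (f u (normalized j x) - F u)) =
    \int[P]_x (f u (normalized i x) * f u (normalized j x)) - F u ^+ 2.
  transitivity (\int[P]_x ((f u (normalized i x) * f u (normalized j x) +
      (- F u) * f u (normalized i x)) + ((- F u) * f u (normalized j x) + F u ^+ 2))).
    by apply: eq_Rintegral => x _; ring.
  have b1 := bounded_mfunZ (- F u) _ (bfi i).
  have b2 := bounded_mfunZ (- F u) _ (bfi j).
  have b3 := @bounded_mfun_cst R _ T (F u ^+ 2).
  have eZ k : \int[P]_x (- F u * f u (normalized k x)) = - F u * F u.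
    by rewrite Rintegral_boundedZ// E_f.
  rewrite Rintegral_boundedD; [|exact: bounded_mfunD|exact: bounded_mfunD].
  rewrite Rintegral_boundedD// Rintegral_boundedD// !eZ.
  rewrite Rintegral_cst// (_ : fine _ = 1); last exact: (congr1 fine (probability_setT P)).
  ring.
have -> : \int[P]_x ((empirical_cdf u x - F u) ^+ 2) = d%:R^-1 ^+ 2 *
   \sum_i \sum_j (\int[P]_x (f u (normalized i x) * f u (normalized j x)) - F u ^+ 2).
  transitivity (\int[P]_x (d%:R^-1 ^+ 2 * \sum_i \sum_j
      ((f u (normalized i x) - F u) * (f u (normalized j x) - F u)))).
    apply: eq_Rintegral => x _.
    under [in RHS]eq_bigr do rewrite -mulr_sumr.
    rewrite -mulr_suml -expr2 -exprMn; congr (_ ^+ 2).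
    rewrite sumrB sumr_const card_ord -[F u *+ d]mulr_natr /empirical_cdf -/(f u _).
    by field; rewrite gt_eqF.
  rewrite Rintegral_boundedZ; last first.
    by apply: bounded_mfun_sum => i; apply: bounded_mfun_sum => j; exact: bounded_mfunM.
  rewrite Rintegral_bounded_sum; last first.
    by move=> i; apply: bounded_mfun_sum => j; exact: bounded_mfunM.
  congr (_ * _); apply: eq_bigr => i _.
  rewrite Rintegral_bounded_sum; last by move=> j; exact: bounded_mfunM.
  by apply: eq_bigr => j _; exact: Eij.
rewrite expr_div_n sqr_sqrtr; last first.
  by apply: sumr_ge0 => i _; apply: sumr_ge0 => j _; exact: sqr_ge0.
rewrite exprVn [leLHS]mulrC [leRHS]mulrAC ler_wpM2r ?invr_ge0 ?exprn_ge0//.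
rewrite mulr_suml; apply: ler_sum => i _.
rewrite mulr_suml; apply: ler_sum => j _.
apply: le_trans (covariance_chi2_1 _ _ _ _ (normalized_pair i j) u u0) _.
rewrite ler_wpM2l ?sqr_ge0//.
have := chi2_1_cdf_le1 u; have := sqr_ge0 (1 - F u); lra.
Qed.

Lemma frob_tSigma_gt0 : (0 < d)%N -> 0 < frob_norm (tSigma Sigma).
Proof.
move=> d0; rewrite sqrtr_gt0.
pose i := Ordinal d0.
rewrite (bigD1 i)//= (bigD1 i)//= tSigma_diag expr1n -addrA ltr_pwDl//.
by apply: addr_ge0; [|apply: sumr_ge0 => j _]; apply: sumr_ge0 => k _; exact: sqr_ge0.
Qed.

Lemma frob_tSigma_le : frob_norm (tSigma Sigma) <= d%:R.
Proof.
rewrite -[leRHS]ger0_norm// -sqrtr_sqr ler_wsqrtr//.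
apply: (@le_trans _ _ (\sum_(i < d) \sum_(j < d) 1)).
  apply: ler_sum => i _; apply: ler_sum => j _.
  rewrite -(real_normK (num_real (tSigma Sigma i j))) exprn_ile1//.
  exact: normr_tSigma_le1.
by rewrite sumr_const sumr_const card_ord -mulrnA expr2 -natrM.
Qed.

(** The coordinate has positive variance, so its law is absolutely continuous. This makes the event
    that some observation vanishes negligible. *)
Lemma gaussian_vector_null i (c : R) : P [set x | eps x i = c] = 0%E.
Proof.
have := geps.2 (two i i 1 0) [set c] (measurable_set1 c).
rewrite quad_two.
rewrite (_ : [set x | [set c] _] = [set x | eps x i = c]); last first.
  by apply/seteqP; split=> x /=; rewrite sum_two mul1r mul0r addr0.
rewrite expr1n mul1r expr0n/= mul0r mulr0 mul0r !addr0 => ->.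
rewrite /gauss_law gt_eqF//.
have /null_content_dominatesP := normal_prob_dominates 0 (Num.sqrt (Sigma i i)).
by apply; [exact: measurable_set1|exact: lebesgue_measure_set1].
Qed.

End gaussian_vector.

(** * Dyadic scales *)

Section dyadic.
Context {R : realType}.

Lemma exists_expn2_gt (m : R) : exists n : nat, m < 2 ^+ n.
Proof.
exists (Num.truncn m).+1; apply: lt_trans (truncnS_gt m) _.
by rewrite -natrX ltr_nat ltn_expl.
Qed.

Lemma dyadic_floor (m : R) : 0 < m -> exists l : int, 2 ^ l <= m < 2 ^ (l + 1).
Proof.
move=> m0; have [n mn] := exists_expn2_gt m; have [n' mn'] := exists_expn2_gt m^-1.
have lo : (2 : R) ^ (- n'%:Z) < m.
  by rewrite -invr_expz -[m]invrK ltf_pV2 ?posrE ?invr_gt0 ?exprn_gt0.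
have ex : exists k, m < (2 : R) ^ (- n'%:Z + k%:Z).
  exists (n' + n)%N; rewrite PoszD addKr; exact: mn.
case: (ex_minnP ex) => k mk kmin.
case: k mk kmin => [|k] mk kmin.
  by move: (lt_trans lo mk); rewrite addr0 ltxx.
exists (- n'%:Z + k%:Z); rewrite -addrA -PoszD addn1 mk andbT leNgt.
by apply/negP => /kmin; rewrite ltnn.
Qed.

Lemma int_min_exists (A : set int) (a b : int) : A b -> (forall k, A k -> a <= k) ->
  exists l, A l /\ forall k, A k -> l <= k.
Proof.
move=> Ab lb.
have ex : exists n : nat, `[< A (a + n%:Z) >].
  exists `|b - a|%N; apply/asboolP; rewrite gez0_abs ?subr_ge0 ?lb//.
  by rewrite [a + _]addrC subrK.
case: (ex_minnP ex) => n /asboolP An nmin; exists (a + n%:Z); split=> // k Ak.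
have ak := lb _ Ak.
rewrite -lerBrDl -(gez0_abs (_ : 0 <= k - a)) ?subr_ge0// lez_nat.
apply: nmin; apply/asboolP; rewrite gez0_abs ?subr_ge0//.
by rewrite [a + _]addrC subrK.
Qed.

End dyadic.

Lemma card_set_sum (d : nat) (b : 'I_d -> bool) :
  #|[set i | b i]%classic| = (\sum_i b i)%N.
Proof.
rewrite -sum1_card big_mkcond; apply: eq_bigr => i _.
by have -> : (i \in [set i | b i]%classic) = b i by apply/idP/idP; rewrite inE.
Qed.

(** * Chi-square quantiles and the relative error they produce *)

Section quantile.
Context {R : realType}.
Local Notation F := (@chi2_1_cdf R).

(** The quantile as a cut: F is compared with p on either side of q, never at q. The infinite case
    is that of p = 1. *)
Variant quantile_spec (p : R) : \bar R -> Prop :=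
| QuantileFin q of 1 / 16 <= q & (forall x, x < q -> F x < p) &
    (forall x, q < x -> p <= F x) : quantile_spec p q%:E
| QuantileInf of (forall x, F x < p) : quantile_spec p +oo%E.

(** F (1/16) <= 1/4 < p keeps the quantile at or above 1/16, which also rules out the value -oo. *)
Lemma chi2_1_quantileP p : 1 / 2 <= p -> quantile_spec p (chi2_1_quantile p).
Proof.
move=> p2.
have lb x : p <= F x -> (chi2_1_quantile p <= x%:E)%E.
  by move=> px; apply: ereal_inf_lbound; exists x.
have ge : ((1 / 16)%:E <= chi2_1_quantile p)%E.
  apply: le_ereal_inf_tmp => _ [x /= px <-]; rewrite lee_fin leNgt.
  apply/negP => /ltW /chi2_1_cdf_nd h.
  have := chi2_1_cdf_small (R := R); lra.
have gt x : (chi2_1_quantile p < x%:E)%E -> p <= F x.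
  move=> /ereal_inf_lt[_ [y /= py <-]]; rewrite lte_fin => /ltW yx.
  by rewrite (le_trans py)// chi2_1_cdf_nd.
case: (chi2_1_quantile p) lb ge gt => [q| |] lb ge gt.
- constructor; first by rewrite -lee_fin.
  + by move=> x xq; rewrite ltNge; apply/negP => /lb; rewrite lee_fin leNgt xq.
  + by move=> x; rewrite -lte_fin; exact: gt.
- constructor => x; rewrite ltNge; apply/negP => /lb.
  by rewrite leye_eq.
- by [].
Qed.

(** Relative error of the estimator at level p and rescaled threshold u = t / sigma^2. An infinite
    quantile makes the estimate 0, hence the error 1. *)
Definition rel_err (p u : R) : R :=
  if chi2_1_quantile p is q%:E then `|u / q - 1| else 1.

Lemma rel_err_crude p u : 1 / 2 <= p -> 0 <= u -> rel_err p u <= 1 + 16 * u.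
Proof.
move=> p2 u0; rewrite /rel_err; case: chi2_1_quantileP => // [q q16 _ _|_]; last lra.
have q0 : 0 < q by lra.
apply: le_trans (ler_normB _ _) _; rewrite normr1 ger0_norm ?divr_ge0 ?(ltW q0)//.
rewrite addrC lerD2l ler_pdivrMr// -mulrA mulrC -mulrA ler_peMr//; nra.
Qed.

(** As q >= 1/16, the error is at most 16 |u - q|, and the slope of F on [0, 2 U] is at least k, so
    k |u - q| <= |p - F u| when q <= 2 U. Otherwise the error is at most 1, while |p - F u| is at
    least k U. *)
Lemma rel_err_lip (U : R) : 0 < U ->
  exists2 K, 0 < K & forall p u, 1 / 2 <= p -> 0 <= u -> u <= U ->
    rel_err p u <= K * `|p - F u|.
Proof.
move=> U0; have UU0 : 0 < 2 * U by rewrite mulr_gt0.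
have [k k0 kF] := chi2_1_cdf_increments (2 * U) UU0.
exists (16 / k + 1 / (k * U)).
  by rewrite addr_gt0// divr_gt0// mulr_gt0.
move=> p u p2 u0 uU.
set D := `|p - F u|; have D0 : 0 <= D by exact: normr_ge0.
have c1 : 0 <= 1 / (k * U) * D by rewrite mulr_ge0// divr_ge0// ltW// mulr_gt0.
have c2 : 0 <= 16 / k * D by rewrite mulr_ge0// divr_ge0// ltW.
have far : F (2 * U) < p -> 1 <= 1 / (k * U) * D.
  move=> FU; rewrite mulrAC ler_pdivlMr ?mulr_gt0// !mul1r.
  have uU2 : u <= 2 * U by lra.
  have h := kF u _ u0 uU2 (lexx _).
  have : k * U <= k * (2 * U - u) by rewrite ler_wpM2l ?(ltW k0)//; lra.
  have : p - F u <= D by exact: ler_norm.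
  lra.
have near (z : R) : k * z <= D -> 16 * z <= 16 / k * D.
  by move=> h; rewrite mulrAC ler_pdivlMr// -mulrA ler_wpM2l// mulrC.
rewrite mulrDl /rel_err; case: chi2_1_quantileP => // [q q16 lo hi|lo]; last first.
  by have := far (lo _); lra.
have q0 : 0 < q by lra.
have qV : q^-1 <= 16.
  by rewrite -[leRHS]invrK lef_pV2 ?posrE ?invr_gt0//; lra.
have -> : `|u / q - 1| = `|u - q| * q^-1.
  rewrite (_ : u / q - 1 = (u - q) / q); last by rewrite mulrBl divff// gt_eqF.
  by rewrite normrM [X in _ * X]ger0_norm ?invr_ge0 ?(ltW q0).
have bnd (z : R) : 0 <= z -> z / q <= 16 * z.
  by move=> z0; rewrite mulrC ler_wpM2r.
have [qu|uq] := leP q u.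
- rewrite ger0_norm ?subr_ge0//.
  have uq0 : 0 <= u - q by rewrite subr_ge0.
  suff h : k * (u - q) <= D by have := near _ h; have := bnd _ uq0; lra.
  rewrite leNgt; apply/negP => h.
  (* Half of the presumed excess, divided by k: F is evaluated at q + e since nothing is known at q,
     and the remaining half still gives a contradiction. *)
  pose e := (k * (u - q) - D) / (2 * k).
  have e0 : 0 < e by rewrite divr_gt0 ?subr_gt0// mulr_gt0.
  have ke : k * e = (k * (u - q) - D) / 2 by rewrite /e; field; exact: lt0r_neq0.
  have h1 := hi (q + e) (_ : q < q + e); rewrite ltrDl in h1; have {}h1 := h1 e0.
  have [qeu|/ltW ueq] := leP (q + e) u.
    have h2 := kF (q + e) u (_ : 0 <= q + e) qeu (_ : u <= 2 * U).
    have {}h2 : k * (u - (q + e)) <= F u - F (q + e) by apply: h2; lra.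
    have : F u - p <= D by rewrite /D distrC ler_norm.
    rewrite opprD mulrDr mulrDr in h2; rewrite mulrBr in h ke; lra.
  have : k * (u - q) <= k * e by rewrite ler_wpM2l ?(ltW k0)//; lra.
  lra.
- rewrite ltr0_norm ?subr_lt0// opprB.
  have uq0 : 0 <= q - u by rewrite subr_ge0 ltW.
  have [UMq|qM] := ltP (2 * U) q.
    have l1 : (q - u) / q <= 1 by rewrite ler_pdivrMr//; lra.
    by have := far (lo _ UMq); lra.
  suff h : k * (q - u) <= D by have := near _ h; have := bnd _ uq0; lra.
  rewrite leNgt; apply/negP => h.
  pose e := (k * (q - u) - D) / (2 * k).
  have e0 : 0 < e by rewrite divr_gt0 ?subr_gt0// mulr_gt0.
  have ke : k * e = (k * (q - u) - D) / 2 by rewrite /e; field; exact: lt0r_neq0.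
  have h1 : F (q - e) < p by apply: lo; lra.
  have [uqe|/ltW qeu] := leP u (q - e).
    have h2 : k * (q - e - u) <= F (q - e) - F u by apply: kF => //; lra.
    have : p - F u <= D by exact: ler_norm.
    rewrite mulrBr mulrBr in h2; rewrite mulrBr in h ke; lra.
  have : k * (q - u) <= k * e by rewrite ler_wpM2l ?(ltW k0)//; lra.
  lra.
Qed.

End quantile.

(** * The estimator for fixed observations *)

Section estimator.
Context {R : realType}.
Variables (d : nat) (Sigma : 'M[R]_d) (Y : 'I_d -> R).
Hypothesis d0 : (0 < d)%N.
Hypothesis diagS : forall i, 0 < Sigma i i.
Local Notation F := (@chi2_1_cdf R).
Local Notation Fh := (Fhat Sigma Y).

Let dR : (0 : R) < d%:R. Proof. by rewrite ltr0n. Qed.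

Lemma FhatE t :
  Fh t = (\sum_i ((Y i / Num.sqrt (Sigma i i)) ^+ 2 <= t)%R%:R) / d%:R.
Proof. by rewrite /Fhat card_set_sum natr_sum. Qed.

Lemma Fhat_nd : {homo Fh : t u / t <= u}.
Proof.
move=> t u tu; rewrite !FhatE ler_wpM2r ?invr_ge0//; apply: ler_sum => i _.
by rewrite ler_nat; case: (leP _ t) => //= /le_trans/(_ tu) ->.
Qed.

(** At scales above all the squares [Fhat] is 1, and at scales below all of them it is 0. The sums
    of the squares and of their inverses serve as bounds for the maxima. *)
Lemma ell_min_exists : (forall i, Y i != 0) -> exists l, ell_min_set Sigma Y l.
Proof.
move=> Y0.
pose w i := (Y i / Num.sqrt (Sigma i i)) ^+ 2.
have w0 i : 0 < w i.
  by rewrite exprn_even_gt0//= mulf_neq0// invr_neq0// gt_eqF// sqrtr_gt0.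
have [n wn] := exists_expn2_gt (\sum_i w i).
have [m wm] := exists_expn2_gt (\sum_i (w i)^-1).
apply: (@int_min_exists _ (- m%:Z) n%:Z).
- rewrite /ell_set /= FhatE (eq_bigr (fun=> 1)).
    by rewrite sumr_const card_ord divff ?gt_eqF//; lra.
  move=> i _; rewrite (_ : (_ <= _) = true)//; apply/ltW.
  apply: le_lt_trans wn; rewrite (bigD1 i)//= lerDl sumr_ge0// => j _.
  by rewrite ltW.
- move=> k; rewrite /ell_set /= FhatE => h; rewrite leNgt; apply/negP => km.
  move: h; rewrite leNgt => /negP; apply; rewrite big1 ?mul0r; first lra.
  move=> i _; rewrite (_ : (_ <= _) = false)//; apply/negbTE.
  rewrite -ltNge -/(w i); apply: (@le_lt_trans _ _ (2 ^ (- m%:Z))).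
    by rewrite ler_weXz2l ?ler1n// ltW.
  rewrite -invr_expz -[w i]invrK ltf_pV2 ?posrE ?invr_gt0 ?w0 ?exprn_gt0//.
  apply: le_lt_trans wm; rewrite (bigD1 i)//= lerDl sumr_ge0// => j _.
  by rewrite invr_ge0 ltW.
Qed.

Lemma sigmaS_t_err (t sigma : R) : 0 < sigma -> 1 / 2 <= Fh t ->
  (`| sigmaS_t Sigma Y t - (sigma ^+ 2)%:E | * (sigma ^+ 2)^-1%:E)%E =
  (rel_err (Fh t) (t / sigma ^+ 2))%:E.
Proof.
move=> s0 Ft; have s20 : 0 < sigma ^+ 2 by rewrite exprn_gt0.
rewrite /sigmaS_t (_ : 0 < Fh t); last by lra.
rewrite /rel_err; case: chi2_1_quantileP => // [q q16 _ _|_].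
- have q0 : 0 < q by lra.
  rewrite -EFinB abse_EFin -EFinM; congr (_%:E).
  rewrite -[X in _ * X]gtr0_norm ?invr_gt0// -normrM; congr (`|_|).
  by field; rewrite !gt_eqF.
- rewrite sub0e abse_EFin -EFinM normrN gtr0_norm// divff// gt_eqF//.
Qed.

End estimator.

(** Coordinates with zero mean contribute equal indicators; each of the at most s others changes the
    count by at most 1. *)
Lemma Fhat_empirical_cdf {R : realType} {dT : measure_display}
    {T : measurableType dT} (d s : nat) (sigma : R)
    (theta : 'I_d -> R) (Sigma : 'M[R]_d) (eps : T -> 'I_d -> R) (x : T) (t : R) :
  (0 < d)%N -> 0 < sigma -> B0 s theta ->
  `|Fhat Sigma (fun i => theta i + sigma * eps x i) t -
    empirical_cdf d Sigma eps (t / sigma ^+ 2) x| <= s%:R / d%:R.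
Proof.
move=> d0 s0; rewrite /B0 /= card_set_sum => hs.
have dR : (0 : R) < d%:R by rewrite ltr0n.
rewrite FhatE /empirical_cdf -mulrBl normrM [X in _ * X]ger0_norm ?invr_ge0//.
rewrite ler_wpM2r ?invr_ge0// -sumrB; apply: le_trans (ler_norm_sum _ _ _) _.
apply: (@le_trans _ _ (\sum_i (theta i != 0)%:R)); last by rewrite -natr_sum ler_nat.
apply: ler_sum => i _; have [th|th] := eqVneq (theta i) 0.
  rewrite th add0r /normalized.
  have -> : ((sigma * eps x i / Num.sqrt (Sigma i i)) ^+ 2 <= t) =
      ((eps x i / Num.sqrt (Sigma i i)) ^+ 2 <= t / sigma ^+ 2).
    by rewrite ler_pdivlMr ?exprn_gt0// -mulrA exprMn mulrC.
  by rewrite subrr normr0.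
by case: (_ <= t); case: (_ <= _ / _); rewrite ?subrr ?subr0 ?sub0r ?normrN ?normr0 ?normr1.
Qed.

(** The integral of a nonnegative function is a supremum over the simple functions below it. This
    bounds the error of the estimator, taken as a mere function, by that of its majorant. *)
Lemma ge0_le_integral_nonmeasurable {R : realType} {d : measure_display}
    {T : measurableType d} (mu : {measure set T -> \bar R}) (f g : T -> \bar R) :
  (forall x, 0 <= f x)%E -> (forall x, f x <= g x)%E ->
  (\int[mu]_x f x <= \int[mu]_x g x)%E.
Proof.
move=> f0 fg; rewrite !ge0_integralTE//; last by move=> x; exact: le_trans (fg x).
apply: ereal_sup_le => _ [h /= hf <-]; exists h => //= x.
exact: le_trans (fg x).
Qed.

Lemma nneseries_geometric_le {R : realType} (a : R) (f : nat -> \bar R) : 0 <= a ->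
  (forall k, 0 <= f k)%E -> (forall k, f k <= (a * 2^-1 ^+ k)%:E)%E ->
  (\sum_(0 <= k <oo) f k <= (2 * a)%:E)%E.
Proof.
move=> a0 f0 fa; apply: lime_le; first by apply: is_cvg_nneseries.
apply: nearW => n.
apply: (@le_trans _ _ (\sum_(0 <= k < n) (a * 2^-1 ^+ k)%:E)%E); first exact: lee_sum.
rewrite sumEFin lee_fin.
suff -> : \sum_(0 <= k < n) a * 2^-1 ^+ k = 2 * a - 2 * a * 2^-1 ^+ n.
  by rewrite gerBl !mulr_ge0// exprn_ge0// invr_ge0.
elim: n => [|n ih]; first by rewrite big_nil expr0 mulr1 subrr.
by rewrite big_nat_recr//= ih exprS; field.
Qed.

(** * Pointwise error in the three ranges of the selected scale *)

Section error_arithmetic.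
Context {R : realType}.

(** Trades a linear deviation for eta plus a quadratic term, whose expectation is of order eta once
    E w^2 <= eta^2. *)
Let amgm (eta w : R) : 0 < eta -> `|w| <= eta + w ^+ 2 / eta.
Proof.
move=> eta0; have : `|w| * eta <= eta * eta + w ^+ 2.
  rewrite -(real_normK (num_real w)); have := sqr_ge0 (`|w| - eta / 2).
  have := sqr_ge0 eta; have := sqr_ge0 `|w|; nra.
by rewrite -ler_pdivlMr// mulrDl mulfK// gt_eqF.
Qed.

Let weight (eta z w : R) : 0 < eta -> 1 / 32 <= z -> w ^+ 2 / eta <= 32 * (z * w ^+ 2 / eta).
Proof.
move=> eta0 z32; rewrite (_ : 32 * _ = 32 * z * (w ^+ 2 / eta)); last by ring.
rewrite ler_peMl//; last by lra.
by rewrite divr_ge0 ?sqr_ge0// ltW.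
Qed.

(** Here [fv] <= 1/4 while n >= 1/2 - 1/8, so the deviation is at least 1/8; the crude error is at
    most 2. *)
Lemma small_scale_error (K r eta v u f n fv : R) : 0 < K -> 0 <= r -> 0 < eta ->
  r <= 1 / 8 -> 1 / 32 <= v -> v <= 1 / 16 ->
  u <= v -> 1 / 2 <= f -> f - r <= n -> fv <= 1 / 4 ->
  1 + 16 * u <= (32 * K + 33 * 64) * (r + eta + v * (n - fv) ^+ 2 / eta).
Proof.
move=> K0 r0 eta0 r8 v32 v16 uv f2 fn fv4.
have : 1 / 8 <= `|n - fv| by apply: le_trans (ler_norm _); lra.
move: (n - fv : R) => w w8.
have h1 := amgm eta w eta0; have h2 := weight eta v w eta0 v32.
have v0 : 0 <= v by lra.
have h3 : 0 <= v * w ^+ 2 / eta by rewrite divr_ge0 ?(ltW eta0)// mulr_ge0 ?sqr_ge0.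
move: (v * w ^+ 2 / eta : R) (w ^+ 2 / eta : R) (`|w| : R) h1 h2 h3 w8 => X Z A h1 h2 h3 w8.
have h4 : 0 <= 32 * K * (r + eta + X).
  by rewrite mulr_ge0 ?addr_ge0 ?(ltW eta0)// mulr_ge0 ?(ltW K0).
have h5 : 1 + 16 * u <= 33 * 64 * (r + eta + X) by lra.
rewrite [leRHS]mulrDl; exact: ler_wpDl h4 h5.
Qed.

Lemma medium_scale_error (K r eta u f n fu : R) : 0 < K -> 0 <= r -> 0 < eta ->
  1 / 32 <= u -> `|f - n| <= r ->
  K * `|f - fu| <= (32 * K + 33 * 64) * (r + eta + u * (n - fu) ^+ 2 / eta).
Proof.
move=> K0 r0 eta0 u32 fn.
have : `|f - fu| <= r + `|n - fu| by apply: le_trans (ler_distD n _ _) _; exact: lerD.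
move: (n - fu : R) => w h0.
have h1 := amgm eta w eta0; have h2 := weight eta u w eta0 u32.
have u0 : 0 <= u by lra.
have h3 : 0 <= u * w ^+ 2 / eta by rewrite divr_ge0 ?(ltW eta0)// mulr_ge0 ?sqr_ge0.
move: (u * w ^+ 2 / eta : R) (w ^+ 2 / eta : R) (`|w| : R) (`|f - fu| : R) h0 h1 h2 h3 => X Z B A h0 h1 h2 h3.
have h4 : K * A <= K * (32 * (r + eta + X)).
  by rewrite ler_wpM2l ?(ltW K0)//; lra.
rewrite [leRHS]mulrDl; apply: ler_wpDr; last by rewrite [32 * K]mulrC -mulrA.
by rewrite !mulr_ge0// !addr_ge0// ltW.
Qed.

(** With n <= 5/8 and [fu] >= 3/4 the deviation is at least 1/8, so its square weighted by u is at
    least u / 64. This pays for the crude error 1 + 32 u <= 33 u, whence the constant 33 * 64. *)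
Lemma large_scale_error (K r eta u f n fu : R) : 0 < K -> 0 <= r -> 0 < eta ->
  r <= 1 / 8 -> eta <= 1 -> 16 <= u ->
  f < 1 / 2 -> n <= f + r -> 3 / 4 <= fu ->
  1 + 16 * (2 * u) <= (32 * K + 33 * 64) * (r + eta + u * (n - fu) ^+ 2 / eta).
Proof.
move=> K0 r0 eta0 r8 eta1 u16 f2 nf fu34.
have : n - fu <= - (1 / 8) by lra.
move: (n - fu : R) => w w18.
have w8 : 1 / 64 <= w ^+ 2 by clear -w18; nra.
have u0 : 0 <= u by lra.
have h1 : u / 64 <= u * w ^+ 2 by have := ler_wpM2l u0 w8; lra.
have h2 : u * w ^+ 2 <= u * w ^+ 2 / eta.
  by rewrite ler_pdivlMr// ler_piMr//; lra.
move: (u * w ^+ 2 : R) (u * w ^+ 2 / eta : R) h1 h2 => Z X h1 h2.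
have X0 : 0 <= X by lra.
have h4 : 0 <= 32 * K * (r + eta + X).
  by rewrite mulr_ge0 ?addr_ge0 ?(ltW eta0)// mulr_ge0 ?(ltW K0).
have h5 : 1 + 16 * (2 * u) <= 33 * 64 * (r + eta + X) by lra.
rewrite [leRHS]mulrDl; exact: ler_wpDl h4 h5.
Qed.

End error_arithmetic.

(** A deterministic statement: N stands for a realization of the c.d.f. of the noise. The index k
    depends on the observations. *)
Lemma estimator_error (R : realType) : exists2 C : R, 0 < C &
  forall (d : nat) (Sigma : 'M[R]_d) (Y : 'I_d -> R) (sigma r eta : R) (l0 : int)
    (N : R -> R),
  (0 < d)%N -> (forall i, 0 < Sigma i i) -> (forall i, Y i != 0) -> 0 < sigma ->
  (forall t, `|Fhat Sigma Y t - N (t / sigma ^+ 2)| <= r) -> r <= 1 / 8 ->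
  1 / 32 < 2 ^ l0 / sigma ^+ 2 <= 1 / 16 -> 0 < eta <= 1 ->
  exists k : nat,
    (`| sigmaS_hat Sigma Y - (sigma ^+ 2)%:E | * (sigma ^+ 2)^-1%:E <=
    (C * (r + eta + 2 ^+ k * (2 ^ l0 / sigma ^+ 2) *
      (N (2 ^+ k * (2 ^ l0 / sigma ^+ 2)) -
       chi2_1_cdf (2 ^+ k * (2 ^ l0 / sigma ^+ 2))) ^+ 2 / eta))%:E)%E.
Proof.
(* 32 = 2^9 / 16 bounds the rescaled threshold in the middle range. *)
have [K K0 Klip] := rel_err_lip (32 : R) (ltr0n _ 32).
exists (32 * K + 33 * 64); first by rewrite addr_gt0 ?mulr_gt0.
move=> d Sigma Y sigma r eta l0 N d0 S0 Y0 s0 FN r8 /andP[v32 v16] /andP[eta0 eta1].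
have s20 : 0 < sigma ^+ 2 by rewrite exprn_gt0.
have r0 : 0 <= r by apply: le_trans (FN 0); exact: normr_ge0.
set v := 2 ^ l0 / sigma ^+ 2 in v32 v16 *.
have ex := ell_min_exists d Sigma Y d0 S0 Y0.
rewrite /sigmaS_hat; case: ifPn => [_|/asboolP//].
set l := xget 0 _; have [lin lmin] : ell_min_set Sigma Y l by exact: xgetPex ex.
have Fl : 1 / 2 <= Fhat Sigma Y (2 ^ l) by exact: lin.
have F2 : forall t, Fhat Sigma Y t - r <= N (t / sigma ^+ 2) <= Fhat Sigma Y t + r.
  by move=> t; have := FN t; rewrite ler_distlC.
have v0 : 0 < v by apply: lt_trans v32; rewrite divr_gt0.
have [ll0|l0l] := leP l l0.
  exists 0%N; rewrite expr0 mul1r sigmaS_t_err// lee_fin.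
  have u0 : 0 <= 2 ^ l / sigma ^+ 2 by rewrite divr_ge0 ?(ltW s20)// exprz_ge0.
  have uv : 2 ^ l / sigma ^+ 2 <= v.
    by rewrite ler_wpM2r ?invr_ge0 ?(ltW s20)// ler_weXz2l// ler1n.
  have F0 : 1 / 2 <= Fhat Sigma Y (2 ^ l0).
    by apply: le_trans Fl _; apply: Fhat_nd => //; rewrite ler_weXz2l// ler1n.
  have /andP[] := F2 (2 ^ l0); rewrite -/v => N1 N2.
  have Fv : chi2_1_cdf v <= 1 / 4.
    exact: le_trans (chi2_1_cdf_nd v (1 / 16) v16) chi2_1_cdf_small.
  apply: le_trans (rel_err_crude _ _ Fl u0) _.
  exact: (small_scale_error _ _ _ _ _ _ _ _ K0 r0 eta0 r8 (ltW v32) v16 uv F0 N1 Fv).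
have [k lk] : exists k : nat, l = l0 + k.+1%:Z.
  pose m := `|l - l0|%N.
  have mE : m%:Z = l - l0 by rewrite gtz0_abs// subr_gt0.
  have m0 : (0 < m)%N by rewrite absz_gt0 subr_eq0 gt_eqF.
  by exists m.-1; rewrite prednK// mE [l0 + _]addrC subrK.
have uE j : 2 ^ (l0 + j%:Z) / sigma ^+ 2 = 2 ^+ j * v.
  by rewrite exprzDr ?unitfE// mulrAC mulrC.
have pow1 j : 1 <= 2 ^+ j :> R by rewrite exprn_ege1// ler1n.
have uge j : 1 / 32 <= 2 ^+ j * v.
  by rewrite (le_trans (ltW v32))// ler_peMl// ltW.
rewrite sigmaS_t_err// [in 2 ^ l / _]lk uE.
(* Beyond 2^9 v, the preceding scale u = 2^k v is at least 2^9 / 32 = 16, where the tail bound 64 /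
   u^2 <= 1/4 applies. *)
have [k9|k9] := leqP k.+1 9.
  exists k.+1; rewrite lee_fin; set u := 2 ^+ k.+1 * v.
  have u0 : 0 <= u by apply: le_trans (uge k.+1); rewrite divr_ge0.
  have u32 : u <= 32.
    have p9 : 2 ^+ k.+1 <= 2 ^+ 9 :> R by rewrite ler_weXn2l// ler1n.
    have p0 : 0 <= 2 ^+ k.+1 :> R by apply: le_trans (pow1 _).
    apply: le_trans (ler_pM p0 (ltW v0) p9 v16) _.
    by rewrite -natrX div1r ler_pdivrMr// -natrM ler_nat.
  apply: le_trans (Klip _ _ Fl u0 u32) _.
  apply: (medium_scale_error _ _ _ _ _ _ _ K0 r0 eta0 (uge k.+1)).
  by have := FN (2 ^ l); rewrite {2}lk uE.
exists k; rewrite lee_fin exprS -mulrA; set u := 2 ^+ k * v.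
have u16 : 16 <= u.
  have p9 : 2 ^+ 9 <= 2 ^+ k :> R by rewrite ler_weXn2l// ler1n.
  apply: le_trans (ler_pM _ _ p9 (ltW v32)) => //.
  by rewrite -natrX div1r ler_pdivlMr// -natrM ler_nat.
(* Minimality of l: the scale just below the selected one fails the test. *)
have Fl' : Fhat Sigma Y (2 ^ (l0 + k%:Z)) < 1 / 2.
  rewrite ltNge; apply/negP => /lmin; rewrite lk lerD2l lez_nat ltnn//.
have /andP[] := F2 (2 ^ (l0 + k%:Z)); rewrite uE -/u => N1 N2.
have u0 : 0 < u by apply: lt_le_trans u16.
have Fu : 3 / 4 <= chi2_1_cdf u.
  move: (chi2_1_cdf u) (chi2_1_tail u u0) => Fu.
  have : 64 / u ^+ 2 <= 1 / 4.
    rewrite ler_pdivrMr ?exprn_gt0//.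
    have : 16 * 16 <= u * u by rewrite ler_pM.
    rewrite expr2; lra.
  lra.
apply: le_trans (rel_err_crude _ _ Fl _) _; first by rewrite mulr_ge0 ?(ltW u0).
exact: (large_scale_error _ _ _ _ _ _ _ K0 r0 eta0 r8 eta1 u16 Fl' N2 Fu).
Qed.

(** * Integration of the pointwise bound over the scales *)

Theorem theorem5 (R : realType) :
  exists C c : R, 0 < C /\ 0 < c /\
  forall (d s : nat) (sigma cstar : R) (theta : 'I_d -> R) (Sigma : 'M[R]_d),
    (1 <= d)%N -> (1 <= s)%N -> s%:R <= c * d%:R ->
    0 < sigma -> @B0 R s d theta ->
    is_cov_matrix Sigma -> 0 < cstar -> (forall i, cstar <= Sigma i i) ->
    forall (dT : measure_display) (T : measurableType dT)
           (P : probability T R) (eps : T -> 'I_d -> R),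
    is_gaussian_vector P Sigma eps ->
    (\int[P]_x
        (`| sigmaS_hat Sigma (fun i => (theta i + sigma * eps x i)%R)
            - (sigma ^+ 2)%:E | * (sigma ^+ 2)^-1%:E)
     <= (C * (s%:R / d%:R + frob_norm (tSigma Sigma) / d%:R))%:E)%E.
Proof.
have [C1 C10 err] := estimator_error R.
(* c = 1/8 ensures r <= 1/8. In C, the 1 accounts for r + eta and 64 * 64 for the series: twice its
   first term 64 eta / v, with 1 / v <= 32. *)
exists (C1 * (1 + 64 * 64)), (1 / 8); split; first by rewrite mulr_gt0// addr_gt0// mulr_gt0.
split; first by rewrite divr_gt0.
move=> d s sigma cstar theta Sigma d0 _ sd s0 B0th covS c0 diag dT T P eps geps.
have dR : (0 : R) < d%:R by rewrite ltr0n.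
have S0 i : 0 < Sigma i i by exact: lt_le_trans (diag i).
have s20 : 0 < sigma ^+ 2 by rewrite exprn_gt0.
set r := s%:R / d%:R; set eta := frob_norm _ / d%:R.
have r0 : 0 <= r by rewrite divr_ge0.
have r8 : r <= 1 / 8 by rewrite ler_pdivrMr.
have eta0 : 0 < eta by rewrite divr_gt0// frob_tSigma_gt0.
have eta1 : eta <= 1.
  by rewrite ler_pdivrMr// mul1r; exact: frob_tSigma_le.
have [l0 /andP[l0le l0lt]] := dyadic_floor (sigma ^+ 2 / 16) (divr_gt0 s20 (ltr0n R 16)).
pose v := 2 ^ l0 / sigma ^+ 2.
have v16 : v <= 1 / 16 by rewrite ler_pdivrMr// mulrC div1r.
have v32 : 1 / 32 < v.
  rewrite ltr_pdivlMr//; move: l0lt; rewrite exprzDr ?unitfE// expr1z.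
  by clear; lra.
have v0 : 0 < v by apply: lt_trans v32; rewrite divr_gt0.
pose u k := 2 ^+ k * v.
have u0 k : 0 < u k by rewrite mulr_gt0// exprn_gt0.
pose W k x := empirical_cdf d Sigma eps (u k) x - chi2_1_cdf (u k).
have bW k : bounded_mfun (fun x => W k x ^+ 2).
  have b : bounded_mfun (W k).
    by apply: bounded_mfunD; [exact: (bounded_empirical_cdf P _ _ _ geps)|exact: bounded_mfun_cst].
  exact: bounded_mfunM.
have EW k : (\int[P]_x (W k x ^+ 2)%:E <= (eta ^+ 2 * (64 / u k ^+ 2))%:E)%E.
  have intW := bounded_mfun_integrable P _ (bW k).
  rewrite -[leLHS]fineK; last exact: integrable_fin_num intW.
  rewrite lee_fin; apply: le_trans (variance_empirical_cdf _ _ _ _ geps covS S0 _ d0 (ltW (u0 k))) _.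
  by rewrite ler_wpM2l ?sqr_ge0// chi2_1_tail.
(* The weight u / eta turns the variance bound 64 eta^2 / u^2 into 64 eta / u, which halves from one
   scale to the next. *)
pose g k x : \bar R := (C1 * (u k * W k x ^+ 2 / eta))%:E.
have mg k : measurable_fun setT (g k).
  apply/measurable_EFinP; apply: measurable_funM => //; apply: measurable_funM => //.
  by apply: measurable_funM => //; case: (bW k).
have c0k k : 0 <= C1 * (u k / eta) by apply: mulr_ge0; [exact: ltW|apply: divr_ge0; exact: ltW].
have g0 k x : (0 <= g k x)%E.
  rewrite lee_fin; apply: mulr_ge0; first exact: ltW.
  apply: divr_ge0; last exact: ltW.
  by apply: mulr_ge0; [exact: ltW|exact: sqr_ge0].
have Eg k : (\int[P]_x g k x <= (64 * C1 * eta / v * 2^-1 ^+ k)%:E)%E.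
  rewrite (_ : (fun x => g k x) = (fun x => (C1 * (u k / eta))%:E * (W k x ^+ 2)%:E)%E); last first.
    by apply/funext => x; rewrite /g -EFinM [u k * _ / _]mulrAC mulrA.
  rewrite ge0_integralZl//; last 3 first.
  - by apply/measurable_EFinP; case: (bW k).
  - by move=> x _; rewrite lee_fin sqr_ge0.
  - by rewrite lee_fin.
  apply: le_trans (lee_wpmul2l _ (EW k)) _; first by rewrite lee_fin.
  rewrite -EFinM lee_fin /u exprVn le_eqVlt; apply/orP; left; apply/eqP.
  by field; rewrite !gt_eqF// exprn_gt0.
(* The null event that observation i is 0, on which the minimal scale may fail to exist. The
   function [h i], infinite there and zero elsewhere, makes the majorant valid at every point with
   no effect on its integral. *)
pose A i := [set x | eps x i = - theta i / sigma].
have mA i : measurable (A i).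
  have := geps.1 i measurableT [set - theta i / sigma] (measurable_set1 _).
  by rewrite setTI.
pose h i : T -> \bar R := (cst +oo%E) \_ (A i).
have mh i : measurable_fun setT (h i).
  by apply: (measurable_restrictT _ (mA i)).1; exact: measurable_cst.
have h0 i x : (0 <= h i x)%E by rewrite /h patchE; case: ifPn => _; [exact: leey|exact: lexx].
have Eh i : (\int[P]_x h i x = 0)%E.
  have PA : P (A i) = 0%E by exact: (gaussian_vector_null _ _ _ _ geps covS S0).
  rewrite -integral_mkcond integral_cst//.
  by transitivity (+oo * P (A i))%E; [by []|rewrite PA mule0].
pose b := (C1 * (r + eta))%:E.
have b0 : (0 <= b)%E by rewrite lee_fin; apply: mulr_ge0; [exact: ltW|apply: addr_ge0 => //; exact: ltW].
pose G x := (b + (\sum_(0 <= k <oo) g k x + \sum_(i < d) h i x))%E.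
have s1 x : (0 <= \sum_(0 <= k <oo) g k x)%E by apply: nneseries_ge0 => k _ _; exact: g0.
have s2 x : (0 <= \sum_(i < d) h i x)%E by apply: sume_ge0 => i _; exact: h0.
have fG x : (`| sigmaS_hat Sigma (fun i => (theta i + sigma * eps x i)%R)
            - (sigma ^+ 2)%:E | * (sigma ^+ 2)^-1%:E <= G x)%E.
  have [/existsP[i /eqP Yi]|/existsPn Y0] :=
      boolP [exists i, theta i + sigma * eps x i == 0].
    have Ai : A i x.
      apply: (mulfI (lt0r_neq0 s0)); rewrite mulrCA divff ?gt_eqF// mulr1.
      by apply/eqP; rewrite -addr_eq0 addrC; apply/eqP.
    have hi : h i x = +oo%E by rewrite /h patchE mem_set.
    have tt : (\sum_(i < d) h i x = +oo)%E.
      by apply/eqP; rewrite -leye_eq -hi (bigD1 i)//= leeDl// sume_ge0.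
    have : (\sum_(i < d) h i x <= G x)%E.
      apply: (@le_trans _ _ (\sum_(0 <= k <oo) g k x + \sum_(i < d) h i x)%E).
        by rewrite leeDr.
      by rewrite /G leeDr.
    by rewrite tt leye_eq => /eqP ->; exact: leey.
  have F1 t := Fhat_empirical_cdf d s sigma theta Sigma eps x t d0 s0 B0th.
  have v3216 : 1 / 32 < 2 ^ l0 / sigma ^+ 2 <= 1 / 16 by rewrite v32.
  have eta01 : 0 < eta <= 1 by rewrite eta0.
  (* Since k varies with x, the single term [g k x] is bounded by the whole series. *)
  have [k hk] := err d Sigma (fun i => theta i + sigma * eps x i) sigma r eta l0
    (fun w => empirical_cdf d Sigma eps w x) d0 S0 Y0 s0 F1 r8 v3216 eta01.
  apply: le_trans hk _; rewrite -/v -/(u k) mulrDr EFinD -/b /G leeD2l//.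
  apply: (@le_trans _ _ (\sum_(0 <= k <oo) g k x)%E); last by rewrite leeDl.
  apply: le_trans (nneseries_lim_ge k.+1 _) => //.
  by rewrite big_nat_recr//= leeDr// sume_ge0.
apply: le_trans (ge0_le_integral_nonmeasurable _ _ _ _ fG) _.
  by move=> x; rewrite mule_ge0// lee_fin invr_ge0 ltW.
have m1 : measurable_fun setT (fun x => \sum_(0 <= k <oo) g k x)%E.
  by apply: ge0_emeasurable_sum.
have m2 : measurable_fun setT (fun x => \sum_(i < d) h i x)%E.
  exact: emeasurable_sum.
rewrite /G ge0_integralD//; last 2 first.
- by move=> x _; rewrite adde_ge0.
- exact: emeasurable_funD.
have Eb : (\int[P]_x b = b)%E.
  rewrite integral_cst//.
  by transitivity (b * P setT)%E; [by []|rewrite probability_setT mule1].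
rewrite ge0_integralD// Eb ge0_integral_sum//.
rewrite (eq_bigr (fun=> 0%E)) ?big1_eq ?adde0//.
rewrite integral_nneseries//.
have a0 : 0 <= 64 * C1 * eta / v.
  by apply: divr_ge0; [apply: mulr_ge0; [apply: mulr_ge0 => //|]|]; exact: ltW.
apply: le_trans (leeD2l _ (nneseries_geometric_le _ _ a0 _ Eg)) _.
  by move=> k; apply: integral_ge0.
rewrite -EFinD lee_fin.
have vV : v^-1 <= 32.
  by rewrite -[leRHS]invrK lef_pV2 ?posrE ?invr_gt0// -div1r ltW.
have h5 : 2 * (64 * C1 * eta / v) <= C1 * (64 * 64 * eta).
  rewrite (_ : 2 * _ = C1 * eta * 128 * v^-1); last by ring.
  rewrite (_ : C1 * (64 * 64 * eta) = C1 * eta * 128 * 32); last by ring.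
  rewrite ler_wpM2l//; apply: mulr_ge0 => //; apply: mulr_ge0; exact: ltW.
apply: le_trans (lerD (lexx _) h5) _.
rewrite -[leLHS]mulrDr -[leRHS]mulrA ler_wpM2l ?(ltW C10)//.
rewrite [leRHS]mulrDl [1 * _]mul1r lerD2l ler_wpM2l ?lerDr//.
Qed.
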